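(* Let $M \in \{0,1\}^{n \times n}$ be a $d$-twin-ordered binary matrix. Then $M$ can be preprocessed in time $\mathcal{O}(n^2+dn)$ so that afterwards, for an arbitrary column vector $v \in \mathbb{R}^n$, each of the products $Mv$ and $v^\intercal M$ can be computed in time $\mathcal{O}(dn)$.
   Context: Running times assume unit-cost arithmetic operations on scalars. Definitions. A division of an $n\times n$ matrix $M$ is a pair $(\mathcal{R},\mathscr{C})$ of partitions of $[n]$ into contiguous non-empty intervals; the cell $(i,j)$ is the submatrix of $M$ with rows in the $i$-th interval of $\mathcal{R}$ and columns in the $j$-th interval of $\mathscr{C}$; a cell is constant if all its entries are equal. A row (resp. column) of the division is the set of cells sharing a given interval of $\mathcal{R}$ (resp. $\mathscr{C}$). A merge sequence of $M$ is a sequence of divisions $(\mathcal{R}_{2n-1},\mathscr{C}_{2n-1}),\dots,(\mathcal{R}_1,\mathscr{C}_1)$ where $\mathcal{R}_{2n-1}=\mathscr{C}_{2n-1}$ is the partition into singletons, $\mathcal{R}_1=\mathscr{C}_1=\{[n]\}$, and each division is obtained from the previous one by merging two adjacent intervals of either the row partition or the column partition (not both). It is $d$-wide if in every division every row and every column contains at most $d$ non-constant cells. $M$ is $d$-twin-ordered if it (in its given row and column order) admits a $d$-wide merge sequence. *)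

(* Defs.v *)
From HB Require Import structures.
From mathcomp Require Import all_boot all_order all_algebra.
From mathcomp Require Import reals.
Set Implicit Arguments. Unset Strict Implicit. Unset Printing Implicit Defensive.
Import Order.TTheory GRing.Theory Num.Theory.

Section TwinOrdered.
Variable n : nat.

Definition contiguous (A : {set 'I_n}) : Prop :=
  forall x y z : 'I_n, x <= y -> y <= z -> x \in A -> z \in A -> y \in A.

(* a partition of [n] into contiguous non-empty intervals
   (mathcomp's [partition] already requires blocks to be non-empty) *)
Definition interval_partition (P : {set {set 'I_n}}) : Prop :=
  partition P [set: 'I_n] /\ forall A, A \in P -> contiguous A.

Definition singleton_partition : {set {set 'I_n}} := [set [set i] | i : 'I_n].

(* {[n]}; for n = 0 the unique partition of the empty set is empty *)
Definition full_partition : {set {set 'I_n}} :=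
  [set A : {set 'I_n} | (A == [set: 'I_n]) && (A != set0)].

Definition merge_step (P P' : {set {set 'I_n}}) : Prop :=
  exists A B, [/\ A \in P, B \in P, A != B, contiguous (A :|: B) &
    P' = (A :|: B) |: ((P :\ A) :\ B)].

Definition division := ({set {set 'I_n}} * {set {set 'I_n}})%type.

Definition division_step (D D' : division) : Prop :=
  (merge_step D.1 D'.1 /\ D'.2 = D.2) \/ (D'.1 = D.1 /\ merge_step D.2 D'.2).

Definition constant_cell (M : 'M[bool]_n) (X Y : {set 'I_n}) : bool :=
  [forall i in X, forall i' in X, forall j in Y, forall j' in Y,
     M i j == M i' j'].

Definition d_wide_division (d : nat) (M : 'M[bool]_n) (D : division) : Prop :=
  (forall X, X \in D.1 -> #|[set Y in D.2 | ~~ constant_cell M X Y]| <= d) /\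
  (forall Y, Y \in D.2 -> #|[set X in D.1 | ~~ constant_cell M X Y]| <= d).

Definition d_wide_merge_sequence (d : nat) (M : 'M[bool]_n) (s : seq division)
  : Prop :=
  [/\ s != [::],
      head (singleton_partition, singleton_partition) s
        = (singleton_partition, singleton_partition),
      last (singleton_partition, singleton_partition) s
        = (full_partition, full_partition),
      (forall k, k.+1 < size s ->
         division_step (nth (set0, set0) s k) (nth (set0, set0) s k.+1)) &
      (forall D, D \in s -> d_wide_division d M D)].

Definition twin_ordered (d : nat) (M : 'M[bool]_n) : Prop :=
  exists s, d_wide_merge_sequence d M s.

End TwinOrdered.

(* A unit-cost RAM with natural-number registers (for addressing /        *)
(* control) and real registers (unit-cost arithmetic on scalars).         *)

Inductive instr : Type :=
| NConst  (r k : nat)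
| NAdd    (r a b : nat)
| NSub    (r a b : nat)          (* N[r] := N[a] - N[b] (truncated)    *)
| NLoadI  (r a : nat)
| NStoreI (a b : nat)
| RConst0 (r : nat)
| RConst1 (r : nat)
| RAdd    (r a b : nat)
| RSub    (r a b : nat)
| RMul    (r a b : nat)
| RLoadI  (r a : nat)
| RStoreI (a b : nat)
| JLt     (a b l : nat)
| Halt.

Definition program := seq instr.

Record state (R : Type) := State {
  pc : nat; nmem : nat -> nat; rmem : nat -> R }.

Section Machine.
Variable R : realType.
Local Open Scope ring_scope.

Definition updN (m : nat -> nat) (a v : nat) := fun x => if x == a then v else m x.
Definition updR (m : nat -> R) (a : nat) (v : R) :=
  fun x => if x == a then v else m x.

Definition halted (p : program) (s : state R) : bool :=
  (size p <= pc s)%N || (if nth Halt p (pc s) is Halt then true else false).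

Definition exec (i : instr) (s : state R) : state R :=
  let N := nmem s in let X := rmem s in let pc1 := (pc s).+1 in
  match i with
  | NConst r k => State pc1 (updN N r k) X
  | NAdd r a b => State pc1 (updN N r (N a + N b)%N) X
  | NSub r a b => State pc1 (updN N r (N a - N b)%N) X
  | NLoadI r a => State pc1 (updN N r (N (N a))) X
  | NStoreI a b => State pc1 (updN N (N a) (N b)) X
  | RConst0 r => State pc1 N (updR X r 0)
  | RConst1 r => State pc1 N (updR X r 1)
  | RAdd r a b => State pc1 N (updR X r (X a + X b))
  | RSub r a b => State pc1 N (updR X r (X a - X b))
  | RMul r a b => State pc1 N (updR X r (X a * X b))
  | RLoadI r a => State pc1 N (updR X r (X (N a)))
  | RStoreI a b => State pc1 N (updR X (N a) (X b))
  | JLt a b l => State (if (N a < N b)%N then l else pc1) N X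
  | Halt => s
  end.

Definition step (p : program) (s : state R) : state R :=
  if halted p s then s else exec (nth Halt p (pc s)) s.

Definition runs_within (p : program) (t : nat) (s s' : state R) : Prop :=
  s' = iter t (step p) s /\ halted p s'.

End Machine.

(* input encoding of the matrix: N[0] = n, N[1 + i*n + j] = M i j, rest 0 *)
Definition matrix_input (R : realType) (n : nat) (M : 'M[bool]_n) : state R :=
  State 0
    (fun a => if a == 0 then n
              else \sum_(i < n) \sum_(j < n) ((a == 1 + i * n + j) * M i j))%N
    (fun _ => 0%R).

Definition query_input (R : realType) (n : nat) (S : state R) (v : 'cV[R]_n)
  : state R :=
  State 0 (nmem S)
    (fun a => match (insub a : option 'I_n) with
              | Some i => v i ord0
              | None => rmem S a
              end).

Definition real_of_bmx (R : realType) (n : nat) (M : 'M[bool]_n) : 'M[R]_n :=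
  map_mx (fun b : bool => ((b : nat)%:R)%R) M.

(* Main.v *)
Require Import Defs.
From HB Require Import structures.
From mathcomp Require Import all_boot all_order all_algebra.
From mathcomp Require Import reals boolp zify ring.
Set Implicit Arguments. Unset Strict Implicit. Unset Printing Implicit Defensive.
Import GRing.Theory.

(** Let D(i,j) = M(i,j) - M(i-1,j) - M(i,j-1) + M(i-1,j-1), entries outside M
being 0.  Call (i,j) with D(i,j) <> 0 alive in a division when neither the rows
i-1, i nor the columns j-1, j have been merged.  A merge of two row intervals
closes a single cut i, and an alive (i,j) on that cut makes the new row
non-constant in the cell of column j or in the cell of column j-1; as each of
the at most d non-constant cells has one first and one last column, at most 2d
alive positions die.  Fewer than 2n merges leave at most one alive position, so
D has O(dn) nonzero entries.

Preprocessing lists these entries in one pass over M.  Since M = L D L^T for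
the lower triangular all-ones matrix L, a product Mv takes suffix sums of v, one
pass over the list, and prefix sums; v^T M is the same with the two indices of
each list entry exchanged. *)

(** * Counting the nonzero second differences *)

(** [d] and the merge sequence enter only through the length of the list, so the preprocessing never
    has to find a merge sequence. What shapes the programs is the machine. They must be the same for
    all [n], [d] and [R], and operands have fixed addresses, which the input already occupies: cell
    0 holds [n], the matrix starts at cell 1, and a query finds [v] in the real cells from 0 on.
    Working space must therefore first be won without losing an entry: by packing bits on the
    natural side, and by the order of the copies on the real side. Naturals cannot be multiplied,
    and no instruction turns a natural into a scalar. But second differences of 0/1 entries take
    only the five values -2, ..., 2, so the shifted difference can serve as an index into a table of
    five scalars. *)

(* M with a zero row and a zero column added in front, and 0 everywhere else. *)
Definition pad n (M : 'M[bool]_n) (i j : nat) : nat :=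
  match i, j with
  | i'.+1, j'.+1 =>
      match insub i' : option 'I_n, insub j' : option 'I_n with
      | Some k, Some l => M k l
      | _, _ => 0
      end
  | _, _ => 0
  end.

(* Second difference, shifted by 2 so that truncated subtraction is exact for
   0/1 entries: the value 2 means that the difference vanishes. *)
Definition corner (A : nat -> nat -> nat) (i j : nat) : nat :=
  A i.+1 j.+1 + A i j + 2 - (A i j.+1 + A i.+1 j).

Section Corners.
Variable n : nat.
Implicit Types (M : 'M[bool]_n) (P : {set {set 'I_n}}) (D : division n).

Lemma padS M (i j : 'I_n) : pad M i.+1 j.+1 = M i j.
Proof. by rewrite /= !valK. Qed.

Lemma pad_le1 M i j : pad M i j <= 1.
Proof.
case: i j => [|i] [|j] //=.
by case: insub => // k; case: insub => // l; case: (M k l).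
Qed.

Lemma pad_tr M i j : pad M^T i j = pad M j i.
Proof.
case: i j => [|i] [|j] //=.
by case: (insub i) => [k|]; case: (insub j) => [l|] //; rewrite mxE.
Qed.

Lemma corner_tr M i j : corner (pad M^T) i j = corner (pad M) j i.
Proof. by rewrite /corner !pad_tr; congr (_ - _); rewrite addnC. Qed.

(** The second difference is the difference in [j] of the row difference [M i j - M k j], so one of
    two neighbouring row differences is nonzero. Left of column 0 there is padding, where the row
    difference vanishes. *)
Lemma corner_split M (i j k : 'I_n) :
  k.+1 = i -> corner (pad M) i j != 2 ->
  M k j <> M i j \/ exists2 l : 'I_n, l.+1 = j & M k l <> M i l.
Proof.
move=> ki; rewrite /corner padS -ki padS ki.
have [-> | /eqP] := eqVneq (M k j) (M i j); last by left.
case ej: (nat_of_ord j) => [|m]; first by rewrite -ki /= !addn0 addKn eqxx.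
have ltm : m < n by have := ltn_ord j; lia.
rewrite -ki (padS M k (Ordinal ltm)) ki (padS M i (Ordinal ltm)) => neq2.
right; exists (Ordinal ltm); first exact: esym.
by move=> eqM; move: neq2; rewrite eqM addKn eqxx.
Qed.

(** A merge sequence is given by its steps only; that its divisions consist of intervals is an
    invariant carried along from the singletons. *)
Definition interval_blocks P : Prop :=
  [/\ forall x, exists2 A, A \in P & x \in A,
      forall A B x, A \in P -> B \in P -> x \in A -> x \in B -> A = B &
      forall A, A \in P -> contiguous A].

Lemma interval_blocks_singleton : interval_blocks (singleton_partition n).
Proof.
split=> [x|A B x /imsetP[a _ ->] /imsetP[b _ ->]|A /imsetP[a _ ->]].
- by exists [set x]; rewrite ?inE // imset_f.
- by rewrite !inE => /eqP<- /eqP<-.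
- by move=> x y z xy yz; rewrite !inE -!val_eqE /=; lia.
Qed.

Lemma interval_blocks_merge P P' :
  interval_blocks P -> merge_step P P' -> interval_blocks P'.
Proof.
case=> cov dis con [A [B [PA PB AB conAB ->]]]; split.
- move=> x; have [E PE xE] := cov x.
  have [xAB|] := boolP (x \in A :|: B).
    by exists (A :|: B) => //; rewrite !inE eqxx.
  rewrite inE negb_or => /andP[xA xB]; exists E => //; rewrite !inE PE.
  by apply/orP; right; rewrite andbT; apply/andP; split;
     apply/eqP => eE; [move: xB | move: xA]; rewrite -eE xE.
- move=> E F x; rewrite !inE.
  case/predU1P=> [->|/and3P[EB EA PE]] /predU1P[->|/and3P[FB FA PF]] //.
  + by rewrite inE => /orP[] xA xF; [move: FA | move: FB];
      rewrite -(dis _ F x _ PF xA xF) ?eqxx.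
  + by rewrite inE => xE /orP[] xA; [move: EA | move: EB];
      rewrite -(dis _ E x _ PE xA xE) ?eqxx.
  + exact: dis.
- by move=> E; rewrite !inE => /predU1P[->|/and3P[_ _ /con]].
Qed.

Lemma card_merge P P' : merge_step P P' -> #|P'| < #|P|.
Proof.
case=> A [B [PA PB AB _ ->]].
rewrite (cardsD1 A P) PA (cardsD1 B (P :\ A)) !inE eq_sym AB PB.
by rewrite cardsU1; case: (_ \in _); lia.
Qed.

(* [border P i]: the cut between rows [i - 1] and [i] has not been merged yet;
   the cut in front of row 0 never is. *)
Definition border P (i : 'I_n) : bool :=
  [forall A in P, forall k : 'I_n,
     (k.+1 == i) ==> ~~ ((k \in A) && (i \in A))].

Lemma borderP P (i : 'I_n) :
  reflect (forall A (k : 'I_n), A \in P -> k.+1 = i -> k \in A -> i \in A -> False)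
          (border P i).
Proof.
apply: (iffP forall_inP) => [H A k PA ki kA iA | H A PA].
  by move/forallP/(_ k): (H A PA); rewrite ki eqxx kA iA.
apply/forallP => k; apply/implyP => /eqP ki; apply/negP => /andP[kA iA].
exact: (H A k).
Qed.

Lemma borderPn P (i : 'I_n) : ~~ border P i ->
  exists A (k : 'I_n), [/\ A \in P, k.+1 = i, k \in A & i \in A].
Proof.
rewrite negb_forall_in => /exists_inP[A PA]; rewrite negb_forall.
case/existsP=> k; rewrite negb_imply negbK => /and3P[/eqP ki kA iA].
by exists A, k.
Qed.

Lemma mem_pblockT P x : interval_blocks P -> x \in pblock P x.
Proof.
case=> cov _ _; rewrite mem_pblock; have [A PA xA] := cov x.
by apply/bigcupP; exists A.
Qed.

Lemma pblockT_mem P x : interval_blocks P -> pblock P x \in P.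
Proof. by move=> iP; rewrite pblock_mem // -mem_pblock mem_pblockT. Qed.

(** A border is the first index of its block: for [i < j] in one block, convexity puts [j - 1] there
    too, and the cut at [j] is closed. *)
Lemma border_pblock_inj P (i j : 'I_n) :
  interval_blocks P -> border P i -> border P j ->
  pblock P i = pblock P j -> i = j.
Proof.
move=> iP; wlog lij: i j / i <= j.
  by move=> W; case: (leqP i j) => [|/ltnW] l bi bj e;
    [apply: W | apply/esym/W].
move=> bi /borderP bj e; apply/eqP; rewrite -val_eqE eqn_leq lij leqNgt /=.
apply/negP => ltij; have lt : j.-1 < n by have := ltn_ord j; lia.
have [_ _ con] := iP.
apply: (bj (pblock P j) (Ordinal lt)); rewrite ?pblockT_mem ?mem_pblockT //=.
  by lia.
apply: (con _ _ i _ j); rewrite ?pblockT_mem ?mem_pblockT //=; try lia.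
by rewrite -e mem_pblockT.
Qed.

(** The mirror image: the index before a border is the last of its block, since otherwise the block
    would reach across that border. *)
Lemma border_pred_pblock_inj P (i j k l : 'I_n) :
  interval_blocks P -> border P i -> border P j -> k.+1 = i -> l.+1 = j ->
  pblock P k = pblock P l -> i = j.
Proof.
move=> iP; wlog lij: i j k l / i <= j.
  by move=> W; case: (leqP i j) => [|/ltnW] ll bi bj ki lj e;
    [apply: (W i j k l) | apply/esym/(W j i l k)].
move=> /borderP bi bj ki lj e; apply/eqP; rewrite -val_eqE eqn_leq lij leqNgt /=.
apply/negP => ltij; have [_ _ con] := iP.
apply: (bi (pblock P k) k); rewrite ?pblockT_mem ?mem_pblockT //=.
apply: (con _ _ k _ l); rewrite ?pblockT_mem ?mem_pblockT //=; try lia.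
by rewrite e mem_pblockT.
Qed.

(** A cut that closes has one side in [A] and the other in [B]. If [i < j] are two such cuts, [i]
    lies between two members of the block that it does not belong to, so convexity puts it in
    both. *)
Lemma merge_border_unique P P' (i j : 'I_n) :
  interval_blocks P -> merge_step P P' ->
  border P i -> ~~ border P' i -> border P j -> ~~ border P' j -> i = j.
Proof.
move=> iP st bi bi' bj bj'.
have [_ dis con] := iP.
case: st => A [B [PA PB AB conAB eP']].
have key (x : 'I_n) : border P x -> ~~ border P' x ->
    exists2 k : 'I_n, k.+1 = x &
      (k \in A /\ x \in B) \/ (k \in B /\ x \in A).
  move=> /borderP bx /borderPn[E [k [PE kx kE xE]]]; exists k => //.
  move: PE; rewrite eP' !inE => /predU1P[eE|/and3P[_ _ PE]]; last first.
    by case: (bx E k).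
  move: kE xE; rewrite eE !inE => /orP[] kE /orP[] xE.
  - by case: (bx A k).
  - by left.
  - by right.
  - by case: (bx B k).
have disj x : x \in A -> x \in B -> False.
  by move=> xA xB; move: AB; rewrite (dis _ _ _ PA PB xA xB) eqxx.
have [k ki Hi] := key i bi bi'; have [l lj Hj] := key j bj bj'.
apply/eqP; rewrite -val_eqE /=; case: ltngtP => // lt; exfalso.
- have [h1 h2 h3] : [/\ k <= i, i <= l & i <= j].
    by split; [rewrite -ltnS ki | rewrite -ltnS lj | exact: ltnW].
  case: Hi => -[kX iX]; case: Hj => -[lX jX].
  + by apply: (disj i) => //; apply: (con _ PA k _ l).
  + by apply: (disj i) => //; apply: (con _ PA k _ j).
  + by apply: (disj i) => //; apply: (con _ PB k _ j).
  + by apply: (disj i) => //; apply: (con _ PB k _ l).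
- have [h1 h2 h3] : [/\ l <= j, j <= k & j <= i].
    by split; [rewrite -ltnS lj | rewrite -ltnS ki | exact: ltnW].
  case: Hi => -[kX iX]; case: Hj => -[lX jX].
  + by apply: (disj j) => //; apply: (con _ PA l _ k).
  + by apply: (disj j) => //; apply: (con _ PB l _ i).
  + by apply: (disj j) => //; apply: (con _ PA l _ i).
  + by apply: (disj j) => //; apply: (con _ PB l _ k).
Qed.

(** * Loss of alive positions under a merge *)

Definition alive M D : {set 'I_n * 'I_n} :=
  [set x : 'I_n * 'I_n | [&& corner (pad M) x.1 x.2 != 2, border D.1 x.1 & border D.2 x.2]].

Lemma non_constant_cell M (X Y : {set 'I_n}) (i k j : 'I_n) :
  i \in X -> k \in X -> j \in Y -> M k j <> M i j -> ~~ constant_cell M X Y.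
Proof.
move=> iX kX jY neq; apply/negP => /forall_inP/(_ k kX)/forall_inP/(_ i iX).
by move=> /forall_inP/(_ j jY)/forall_inP/(_ j jY)/eqP.
Qed.

Lemma card_corners_row d M (C : {set {set 'I_n}}) (X : {set 'I_n}) (i k : 'I_n) :
  interval_blocks C -> k.+1 = i -> i \in X -> k \in X ->
  #|[set Y in C | ~~ constant_cell M X Y]| <= d ->
  #|[set j : 'I_n | (corner (pad M) i j != 2) && border C j]| <= d + d.
Proof.
move=> iC ki iX kX led.
(* [J1] has the columns that are first in a non-constant cell, [J2] those whose predecessor is last
   in one. Sending a column, or its predecessor, to its block is injective there. *)
pose J1 := [set j : 'I_n | border C j && ~~ constant_cell M X (pblock C j)].
pose J2 := [set j : 'I_n | border C j &&
  [exists l : 'I_n, (l.+1 == j) && ~~ constant_cell M X (pblock C l)]].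
have sub : [set j : 'I_n | (corner (pad M) i j != 2) && border C j] \subset J1 :|: J2.
  apply/subsetP => j; rewrite !inE => /andP[ne2 ->] /=.
  case: (corner_split ki ne2) => [neq|[l lj neq]].
    by rewrite (non_constant_cell iX kX _ neq) // mem_pblockT.
  apply/orP; right; apply/existsP; exists l.
  by rewrite lj eqxx (non_constant_cell iX kX _ neq) // mem_pblockT.
apply: leq_trans (subset_leq_card sub) _; rewrite cardsU.
apply: leq_trans (leq_subr _ _) _; apply: leq_add; apply: leq_trans led.
  rewrite -(@card_in_imset _ _ (pblock C)) => [|a b].
    apply: subset_leq_card; apply/subsetP => _ /imsetP[j + ->].
    by rewrite !inE pblockT_mem // => /andP[].
  by rewrite !inE => /andP[ba _] /andP[bb _]; apply: border_pblock_inj.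
(* The default is met only at column 0, which has no predecessor and is not in [J2]. *)
pose pr (j : 'I_n) : 'I_n := odflt j [pick l : 'I_n | l.+1 == j].
have prE j : j \in J2 -> (pr j).+1 = j /\ ~~ constant_cell M X (pblock C (pr j)).
  rewrite inE => /andP[_ /existsP[l /andP[/eqP lj nc]]].
  rewrite /pr; case: pickP => [a /eqP aj|/(_ l)]; last by rewrite lj eqxx.
  by have -> : a = l by apply: val_inj => /=; lia.
rewrite -(@card_in_imset _ _ (pblock C \o pr)) => [|a b Ja Jb].
  apply: subset_leq_card; apply/subsetP => _ /imsetP[j /prE[_ nc] ->].
  by rewrite inE pblockT_mem.
have [pa _] := prE a Ja; have [pb _] := prE b Jb; move: Ja Jb.
rewrite !inE => /andP[ba _] /andP[bb _].
exact: (border_pred_pblock_inj iC ba bb pa pb).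
Qed.

Lemma alive_merge_rows d M (P P' C : {set {set 'I_n}}) :
  interval_blocks P -> interval_blocks C -> merge_step P P' ->
  d_wide_division d M (P', C) ->
  #|alive M (P, C)| <= #|alive M (P', C)| + (d + d).
Proof.
move=> iP iC st [wide _].
have [/existsP[i /andP[bi bi']]|/existsPn none] :=
  boolP [exists i, border P i && ~~ border P' i]; last first.
  apply: leq_trans (leq_addr _ _); apply: subset_leq_card.
  apply/subsetP => -[i j]; rewrite !inE /= => /and3P[-> bi ->].
  by move: (none i); rewrite bi /= negbK => ->.
(* Width is used after the merge, because only then do rows [k] and [i] share a block [X]. *)
have [X [k [PX ki kX iX]]] := borderPn bi'.
pose J := [set j : 'I_n | (corner (pad M) i j != 2) && border C j].
have sub : alive M (P, C) \subset alive M (P', C) :|: [set (i, j) | j in J].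
  apply/subsetP => -[x j]; rewrite !inE /= => /and3P[ne bx bj].
  have [bx'|bx'] := boolP (border P' x); first by rewrite ne bj.
  have ex := merge_border_unique iP st bi bi' bx bx'; subst x.
  by apply/orP; right; apply/imsetP; exists j; rewrite // inE ne bj.
apply: leq_trans (subset_leq_card sub) _; rewrite cardsU.
apply: leq_trans (leq_subr _ _) _; rewrite leq_add2l.
apply: leq_trans (leq_imset_card _ _) _.
exact: card_corners_row iC ki iX kX (wide X PX).
Qed.

(** Transposition turns column merges into row merges, so [alive_merge_rows] serves for both. *)
Lemma alive_tr M (P C : {set {set 'I_n}}) :
  #|alive M^T (C, P)| = #|alive M (P, C)|.
Proof.
pose sw (x : 'I_n * 'I_n) := (x.2, x.1).
have sw_inj : injective sw by move=> [i j] [k l] [-> ->].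
rewrite -(card_imset _ sw_inj); apply: eq_card => -[i j].
rewrite inE /=; apply/imsetP/idP => [[[a b]]|/and3P[h1 h2 h3]].
  by rewrite inE /= corner_tr => /and3P[h1 h2 h3] [-> ->]; apply/and3P.
by exists (j, i); rewrite // inE /= corner_tr h1 h2 h3.
Qed.

Lemma constant_cell_tr M (X Y : {set 'I_n}) :
  constant_cell M^T Y X = constant_cell M X Y.
Proof.
apply/idP/idP => H; apply/forall_inP => i iX; apply/forall_inP => i' i'X;
  apply/forall_inP => j jY; apply/forall_inP => j' j'Y.
  move/forall_inP/(_ j jY)/forall_inP/(_ j' j'Y): H.
  by move=> /forall_inP/(_ i iX)/forall_inP/(_ i' i'X); rewrite !mxE.
move/forall_inP/(_ j jY)/forall_inP/(_ j' j'Y): H.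
by move=> /forall_inP/(_ i iX)/forall_inP/(_ i' i'X); rewrite !mxE.
Qed.

Lemma d_wide_division_tr d M (P C : {set {set 'I_n}}) :
  d_wide_division d M (P, C) -> d_wide_division d M^T (C, P).
Proof.
case=> wr wc; split=> [X /= CX | Y /= PY].
  apply: leq_trans (wc X CX); apply: eq_leq; apply: eq_card => Y.
  by rewrite !inE constant_cell_tr.
apply: leq_trans (wr Y PY); apply: eq_leq; apply: eq_card => X.
by rewrite !inE constant_cell_tr.
Qed.

Lemma alive_step d M D D' :
  interval_blocks D.1 -> interval_blocks D.2 -> division_step D D' ->
  d_wide_division d M D' ->
  #|alive M D| <= #|alive M D'| + (d + d).
Proof.
case: D D' => [P C] [P' C'] /= iP iC [[/= st ->]|[/= -> st]] wide.
  exact: alive_merge_rows.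
by rewrite -(alive_tr M P) -(alive_tr M P);
  apply: alive_merge_rows => //; apply: d_wide_division_tr.
Qed.

(** The number of blocks is a potential: each merge lowers it by at least one and kills at most
    [d + d] alive positions. *)
Lemma alive_sequence d M (s : seq (division n)) D :
  interval_blocks D.1 -> interval_blocks D.2 ->
  (forall k, k < size s ->
     division_step (nth (set0, set0) (D :: s) k) (nth (set0, set0) s k)) ->
  (forall D', D' \in s -> d_wide_division d M D') ->
  #|alive M D| <=
    #|alive M (last D s)| + (d + d) * (#|D.1| + #|D.2|).
Proof.
elim: s D => [|D' s IHs] D i1 i2 st wide /=; first exact: leq_addr.
have st0 : division_step D D' by apply: (st 0).
have wD' : d_wide_division d M D' by apply: wide; rewrite inE eqxx.
have := alive_step i1 i2 st0 wD'.
have [i1' i2' lt] : [/\ interval_blocks D'.1, interval_blocks D'.2 &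
    #|D'.1| + #|D'.2| < #|D.1| + #|D.2|].
  case: st0 => [[m ->]|[-> m]]; split=> //.
  - exact: interval_blocks_merge m.
  - by rewrite ltn_add2r card_merge.
  - exact: interval_blocks_merge m.
  - by rewrite ltn_add2l card_merge.
have := IHs D' i1' i2' (fun k hk => st k.+1 hk).
have wide' D0 : D0 \in s -> d_wide_division d M D0.
  by move=> sD; apply: wide; rewrite inE sD orbT.
move/(_ wide'); move: lt; set x := _ + #|D'.2|; set y := _ + #|D.2| => lt.
have le : (d + d) * x.+1 <= (d + d) * y by rewrite leq_mul2l lt orbT.
move: le; rewrite mulnS.
move: #|alive M D| #|alive M D'| #|alive M (last D' s)| => a b c.
by move: (d + d) => e; move: (e * x) (e * y) => ex ey; clear; lia.
Qed.

Lemma card_corners d M : twin_ordered d M ->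
  #|[set x : 'I_n * 'I_n | corner (pad M) x.1 x.2 != 2]| <= 4 * d * n + 1.
Proof.
case=> -[[]|D s [_ /= eD el st wide]] //; subst D.
set S := singleton_partition n in el st wide *.
have iS : interval_blocks S by apply: interval_blocks_singleton.
have wide' D' : D' \in s -> d_wide_division d M D'.
  by move=> sD'; apply: wide; rewrite inE sD' orbT.
have := @alive_sequence d M s (S, S) iS iS st wide'; rewrite el /= => H.
have cS : #|S| = n by rewrite card_imset ?card_ord //; apply: set1_inj.
have aS : [set x : 'I_n * 'I_n | corner (pad M) x.1 x.2 != 2]
    \subset alive M (S, S).
  have bS i : border S i.
    apply/borderP => A k /imsetP[a _ ->] ki; rewrite !inE => /eqP <- /eqP e.
    by move: ki; rewrite e; lia.
  by apply/subsetP => -[i j]; rewrite !inE /= !bS !andbT.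
(* Source of the [+ 1]: in the last division only the cuts in front of index 0 are open, so only
   position (0, 0) can be alive. The [4 * d * n] is [d + d] for each of the [n + n] initial
   blocks. *)
have aF : #|alive M (full_partition n, full_partition n)| <= 1.
  have bF (i : 'I_n) : border (full_partition n) i -> i = 0 :> nat.
    move=> /borderP b; case ei: (i : nat) => [//|m]; exfalso.
    have lt : m < n by have := ltn_ord i; lia.
    apply: (b setT (Ordinal lt)); rewrite ?inE //= eqxx /=.
    by apply/set0Pn; exists i; rewrite inE.
  apply/card_le1_eqP => -[i j] [k l]; rewrite !inE /=.
  move=> /and3P[_ /bF i0 /bF j0] /and3P[_ /bF k0 /bF l0].
  by congr pair; apply: val_inj; rewrite /= ?i0 ?j0 ?k0 ?l0.
apply: leq_trans (subset_leq_card aS) _; apply: leq_trans H _.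
rewrite cS addnC; apply: leq_add => //.
by rewrite !mulnDr !mulnDl; clear; lia.
Qed.

End Corners.

(** * Structured programs on the RAM *)

(** Each control form uses a single [JLt]. A loop tested at its end runs its body at least once, so
    [n = 0] and an empty list have to be guarded by [Unless]. *)
Inductive cmd : Type :=
| Blk (b : seq instr)
| Seq (c1 c2 : cmd)
| Unless (a b : nat) (c : cmd)
| Loop (c : cmd) (a b : nat).

Fixpoint cmd_size (c : cmd) : nat :=
  match c with
  | Blk b => size b
  | Seq c1 c2 => cmd_size c1 + cmd_size c2
  | Unless _ _ c => (cmd_size c).+1
  | Loop c _ _ => (cmd_size c).+1
  end.

(* [Unless a b c] skips [c] when N[a] < N[b];
   [Loop c a b] repeats [c] (at least once) while N[a] < N[b]. *)
Fixpoint code (off : nat) (c : cmd) : program :=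
  match c with
  | Blk b => b
  | Seq c1 c2 => code off c1 ++ code (off + cmd_size c1) c2
  | Unless a b c => JLt a b (off + (cmd_size c).+1) :: code off.+1 c
  | Loop c a b => code off c ++ [:: JLt a b off]
  end.

Lemma size_code off c : size (code off c) = cmd_size c.
Proof.
elim: c off => [b|c1 IH1 c2 IH2|a b c IH|c IH a b] off //=.
- by rewrite size_cat IH1 IH2.
- by rewrite IH.
- by rewrite size_cat IH addn1.
Qed.

Section Runs.
Variable R : realType.
Implicit Types (N h : nat -> nat) (X : nat -> R) (c : cmd) (p : program).

Definition post := (nat -> nat) -> (nat -> R) -> Prop.

(** A total-correctness triple with a time bound. Jump targets are absolute, so quantifying over the
    surrounding code is what makes triples compose; [t <= T] lets branches of unequal length share a
    bound. *)
Definition runs c N X (T : nat) (Q : post) : Prop :=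
  forall p1 p2, exists t N' X', [/\ t <= T,
    iter t (step (p1 ++ code (size p1) c ++ p2)) (State (size p1) N X)
      = State (size p1 + cmd_size c) N' X' & Q N' X'].

Lemma runs_weaken c N X T T' (Q Q' : post) :
  T <= T' -> (forall N' X', Q N' X' -> Q' N' X') ->
  runs c N X T Q -> runs c N X T' Q'.
Proof.
move=> leT sQ H p1 p2; have [t [N' [X' [lt e q]]]] := H p1 p2.
by exists t, N', X'; split=> //; [apply: leq_trans leT | apply: sQ].
Qed.

Lemma runs_conseq c N X T (Q Q' : post) :
  runs c N X T Q -> (forall N' X', Q N' X' -> Q' N' X') -> runs c N X T Q'.
Proof. by move=> H sQ; apply: runs_weaken H. Qed.

Lemma runs_time c N X T T' (Q : post) :
  T <= T' -> runs c N X T Q -> runs c N X T' Q.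
Proof. by move=> leT; apply: runs_weaken. Qed.

Lemma runs_seq c1 c2 N X T1 T2 (Q : post) :
  runs c1 N X T1 (fun N' X' => runs c2 N' X' T2 Q) ->
  runs (Seq c1 c2) N X (T1 + T2) Q.
Proof.
move=> H p1 p2 /=.
have [t1 [N1 [X1 [l1 e1 H2]]]] := H p1 (code (size p1 + cmd_size c1) c2 ++ p2).
have [t2 [N2 [X2 [l2 e2 q]]]] := H2 (p1 ++ code (size p1) c1) p2.
exists (t2 + t1), N2, X2; split=> //; first by rewrite addnC leq_add.
rewrite iterD -(catA (code _ c1)) e1; move: e2.
by rewrite size_cat size_code -!catA addnA.
Qed.

Lemma nth_mid p1 i p2 : nth Halt (p1 ++ i :: p2) (size p1) = i.
Proof. by rewrite nth_cat ltnn subnn. Qed.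

Lemma step_mid p1 i p2 N X :
  (if i is Halt then false else true) ->
  step (p1 ++ i :: p2) (State (size p1) N X) = exec i (State (size p1) N X).
Proof.
move=> nh; rewrite /step /halted /= nth_mid size_cat /= leqNgt.
by rewrite -{1}[size p1]addn0 ltn_add2l /=; case: i nh.
Qed.

Lemma runs_unless a b c N X T (Q : post) :
  (N a < N b -> Q N X) -> (N b <= N a -> runs c N X T Q) ->
  runs (Unless a b c) N X T.+1 Q.
Proof.
move=> HQ HR p1 p2 /=; case: ltnP (HQ) (HR) => lab; last first.
  move=> _ /(_ isT)/(_ (p1 ++ [:: JLt a b (size p1 + (cmd_size c).+1)]) p2).
  case=> t [N' [X' [lt e q]]]; exists t.+1, N', X'; split=> //.
  rewrite iterSr step_mid //= ltnNge lab /=.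
  by move: e; rewrite size_cat /= -catA addn1 /= addSnnS.
move=> /(_ isT) q _; exists 1, N, X; split=> //=.
by rewrite step_mid //= lab.
Qed.

(** The index of [I] counts the rounds that remain after the current one, hence [k.+1] rounds, each
    with one more step for the jump. *)
Lemma runs_loop c a b N X T (Q : post) (I : nat -> post) k :
  (forall k N X, I k N X -> runs c N X T (fun N' X' =>
     if k is k'.+1 then N' a < N' b /\ I k' N' X'
     else N' b <= N' a /\ Q N' X')) ->
  I k N X -> runs (Loop c a b) N X (k.+1 * T.+1) Q.
Proof.
move=> H Ik p1 p2 /=; elim: k N X Ik => [|k IHk] N X Ik.
  have [t [N' [X' [lt e [lba q]]]]] := H _ _ _ Ik p1 (JLt a b (size p1) :: p2).
  exists t.+1, N', X'; split=> //; first by rewrite mul1n.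
  rewrite -catA /= e catA -(size_code (size p1) c) -size_cat step_mid //=.
  by rewrite ltnNge lba /= size_cat addnS.
have [t [N1 [X1 [lt e [lab I1]]]]] := H _ _ _ Ik p1 (JLt a b (size p1) :: p2).
have [t' [N' [X' [lt' e' q]]]] := IHk _ _ I1.
exists (t' + t.+1), N', X'; split=> //; first by rewrite mulSn addnC leq_add.
rewrite iterD -e' /= -catA /= e; congr (iter _ _ _).
by rewrite catA -(size_code (size p1) c) -size_cat step_mid //= lab.
Qed.

(** Leaving the code at its end counts as halting, and [step] fixes a halted state, so the remaining
    [T - t] steps are idle. *)
Lemma runs_halt c N X T (Q : post) :
  runs c N X T Q ->
  exists S, runs_within (code 0 c) T (State 0 N X) S /\ Q (nmem S) (rmem S).
Proof.
move=> /(_ [::] [::]) [t [N' [X' [lt e q]]]].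
rewrite cats0 /= add0n in e.
exists (State (cmd_size c) N' X'); split=> //.
have hS : halted (code 0 c) (State (cmd_size c) N' X').
  by rewrite /halted /= size_code leqnn.
split=> //; rewrite -(subnK lt) iterD e.
by elim: (T - t) => //= m <-; rewrite /step hS.
Qed.

(** Registers in an explicit list can be evaluated by computation. The list masks [h], so [h] may
    stay the original input while registers change. *)
Definition split_mem (l : seq nat) h : nat -> nat :=
  fun x => if x < size l then nth 0 l x else h x.

Lemma split_mem_reg l h r v : r < size l ->
  updN (split_mem l h) r v = split_mem (set_nth 0 l r v) h.
Proof.
move=> lr; apply: funext => x; rewrite /updN /split_mem size_set_nth.
rewrite (maxn_idPr lr) nth_set_nth /=; case: eqP => [->|//].
by rewrite lr.
Qed.

Lemma split_mem_heap l h a v : size l <= a ->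
  updN (split_mem l h) a v = split_mem l (updN h a v).
Proof.
move=> la; apply: funext => x; rewrite /updN /split_mem.
by case: eqP => [->|//]; rewrite ltnNge la.
Qed.

Lemma split_mem_mkseq h k : split_mem (mkseq h k) h = h.
Proof.
apply: funext => x; rewrite /split_mem size_mkseq.
by case: ifP => // lx; rewrite nth_mkseq.
Qed.

(** Claims [k] more cells as registers: relocation works with 8, since the matrix still lies behind
    them, and the scan with 16. *)
Lemma split_mem_extend l h k :
  split_mem l h = split_mem (l ++ mkseq (fun i => h (size l + i)) k) h.
Proof.
apply: funext => x; rewrite /split_mem size_cat size_mkseq nth_cat.
case: (ltnP x (size l)) => [lx|lx]; first by rewrite ltn_addr.
by case: ifP => // ltx; rewrite nth_mkseq ?subnKC //; lia.
Qed.

(** Operands inside the list keep [set_nth] from lengthening it; without jumps, a block takes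
    exactly as many steps as it has instructions. *)
Definition block_ok (k : nat) (b : seq instr) : bool :=
  all (fun i => match i with
    | NConst r _ => r < k
    | NAdd r a b | NSub r a b => [&& r < k, a < k & b < k]
    | NLoadI a b | NStoreI a b => (a < k) && (b < k)
    | RLoadI _ a | RStoreI a _ => a < k
    | JLt _ _ _ | Halt => false
    | _ => true
    end) b.

(* Symbolic execution of a straight-line block on a memory whose registers
   form the explicit list [l] and whose remaining cells are given by [h]. *)
Fixpoint block_wp (b : seq instr) (l : seq nat) h X
    (Q : seq nat -> post) : Prop :=
  match b with
  | [::] => Q l h X
  | i :: b' =>
    match i with
    | NConst r k => block_wp b' (set_nth 0 l r k) h X Q
    | NAdd r a b =>
        block_wp b' (set_nth 0 l r (nth 0 l a + nth 0 l b)) h X Q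
    | NSub r a b =>
        block_wp b' (set_nth 0 l r (nth 0 l a - nth 0 l b)) h X Q
    | NLoadI r a => size l <= nth 0 l a /\
        block_wp b' (set_nth 0 l r (h (nth 0 l a))) h X Q
    | NStoreI a b => size l <= nth 0 l a /\
        block_wp b' l (updN h (nth 0 l a) (nth 0 l b)) X Q
    | RConst0 r => block_wp b' l h (updR X r 0%R) Q
    | RConst1 r => block_wp b' l h (updR X r 1%R) Q
    | RAdd r a b => block_wp b' l h (updR X r (X a + X b)%R) Q
    | RSub r a b => block_wp b' l h (updR X r (X a - X b)%R) Q
    | RMul r a b => block_wp b' l h (updR X r (X a * X b)%R) Q
    | RLoadI r a => block_wp b' l h (updR X r (X (nth 0 l a))) Q
    | RStoreI a b => block_wp b' l h (updR X (nth 0 l a) (X b)) Q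
    | JLt _ _ _ | Halt => False
    end
  end.

Lemma runs_block b l h X T (Q : post) :
  block_ok (size l) b -> size b <= T ->
  block_wp b l h X (fun l' h' X' => Q (split_mem l' h') X') ->
  runs (Blk b) (split_mem l h) X T Q.
Proof.
move=> ok leT H p1 p2 /=.
suff [N' [X' [e q]]] : exists N' X',
    iter (size b) (step (p1 ++ b ++ p2)) (State (size p1) (split_mem l h) X)
    = State (size p1 + size b) N' X' /\ Q N' X'.
  by exists (size b), N', X'.
elim: b l h X p1 {leT} ok H => [|i b IHb] l h X p1 /=.
  by move=> _ H; exists (split_mem l h), X; rewrite addn0.
case/andP=> oki okb H.
have next l1 h1 X1 : size l1 = size l ->
   exec i (State (size p1) (split_mem l h) X) =
     State (size p1).+1 (split_mem l1 h1) X1 ->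
   block_wp b l1 h1 X1 (fun l' h' X' => Q (split_mem l' h') X') ->
   exists N' X', iter (size b).+1 (step (p1 ++ i :: b ++ p2))
      (State (size p1) (split_mem l h) X) =
     State (size p1 + (size b).+1) N' X' /\ Q N' X'.
  move=> sl ei H1; rewrite iterSr step_mid ?ei; last by case: (i) oki.
  have [||N' [X' [e q]]] := IHb l1 h1 X1 (rcons p1 i); rewrite ?sl //.
  exists N', X'; split=> //; move: e.
  by rewrite size_rcons -cats1 -catA /= addSnnS.
have ss r v : r < size l -> size (set_nth 0 l r v) = size l.
  by move=> lr; rewrite size_set_nth (maxn_idPr lr).
have rd x : x < size l -> split_mem l h x = nth 0 l x.
  by rewrite /split_mem => ->.
have rh x : size l <= x -> split_mem l h x = h x.
  by rewrite /split_mem ltnNge => ->.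
case: i oki H next => //=.
- move=> r k lr H next; apply: (next _ _ _ _ _ H); rewrite ?ss //.
  by rewrite split_mem_reg.
- move=> r x y /and3P[lr lx ly] H next.
  by apply: (next _ _ _ _ _ H); rewrite ?ss // split_mem_reg ?rd.
- move=> r x y /and3P[lr lx ly] H next.
  by apply: (next _ _ _ _ _ H); rewrite ?ss // split_mem_reg ?rd.
- move=> r x /andP[lr lx] [ly H] next.
  by apply: (next _ _ _ _ _ H); rewrite ?ss // split_mem_reg ?(rd x) ?rh.
- move=> x y /andP[lx ly] [lh H] next.
  by apply: (next _ _ _ _ _ H); rewrite // ?(rd x) ?(rd y) ?split_mem_heap.
- by move=> r _ H next; apply: (next _ _ _ _ _ H).
- by move=> r _ H next; apply: (next _ _ _ _ _ H).
- by move=> r x y _ H next; apply: (next _ _ _ _ _ H).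
- by move=> r x y _ H next; apply: (next _ _ _ _ _ H).
- by move=> r x y _ H next; apply: (next _ _ _ _ _ H).
- by move=> r x lx H next; apply: (next _ _ _ _ _ H); rewrite ?rd.
- by move=> r x lx H next; apply: (next _ _ _ _ _ H); rewrite ?rd.
Qed.

Lemma runs_block_seq b c l h X T (Q : post) :
  block_ok (size l) b ->
  block_wp b l h X (fun l' h' X' => runs c (split_mem l' h') X' T Q) ->
  runs (Seq (Blk b) c) (split_mem l h) X (size b + T) Q.
Proof. by move=> ok H; apply: runs_seq; apply: runs_block. Qed.

(* Unfolding [block_wp] on a whole block at once would duplicate the
   unevaluated register list exponentially often; these rules evaluate it
   after each instruction. *)
Section Steps.
Variables (b : seq instr) (l l' : seq nat) (h : nat -> nat) (X : nat -> R).
Variable Q : seq nat -> post.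

Lemma wp_nconst r k : set_nth 0 l r k = l' ->
  block_wp b l' h X Q -> block_wp (NConst r k :: b) l h X Q.
Proof. by move=> <-. Qed.

Lemma wp_nadd r x y : set_nth 0 l r (nth 0 l x + nth 0 l y) = l' ->
  block_wp b l' h X Q -> block_wp (NAdd r x y :: b) l h X Q.
Proof. by move=> <-. Qed.

Lemma wp_nsub r x y : set_nth 0 l r (nth 0 l x - nth 0 l y) = l' ->
  block_wp b l' h X Q -> block_wp (NSub r x y :: b) l h X Q.
Proof. by move=> <-. Qed.

Lemma wp_nload r x : set_nth 0 l r (h (nth 0 l x)) = l' ->
  size l <= nth 0 l x ->
  block_wp b l' h X Q -> block_wp (NLoadI r x :: b) l h X Q.
Proof. by move=> <-. Qed.

Lemma wp_nstore x y a v : nth 0 l x = a -> nth 0 l y = v -> size l <= a ->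
  block_wp b l (updN h a v) X Q -> block_wp (NStoreI x y :: b) l h X Q.
Proof. by move=> <- <-. Qed.

Lemma wp_rload r x a : nth 0 l x = a ->
  block_wp b l h (updR X r (X a)) Q -> block_wp (RLoadI r x :: b) l h X Q.
Proof. by move=> <-. Qed.

Lemma wp_rstore x y a : nth 0 l x = a ->
  block_wp b l h (updR X a (X y)) Q -> block_wp (RStoreI x y :: b) l h X Q.
Proof. by move=> <-. Qed.

Lemma wp_rconst0 r :
  block_wp b l h (updR X r 0%R) Q -> block_wp (RConst0 r :: b) l h X Q.
Proof. by []. Qed.

Lemma wp_rconst1 r :
  block_wp b l h (updR X r 1%R) Q -> block_wp (RConst1 r :: b) l h X Q.
Proof. by []. Qed.

Lemma wp_radd r x y : block_wp b l h (updR X r (X x + X y)%R) Q ->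
  block_wp (RAdd r x y :: b) l h X Q.
Proof. by []. Qed.

Lemma wp_rsub r x y : block_wp b l h (updR X r (X x - X y)%R) Q ->
  block_wp (RSub r x y :: b) l h X Q.
Proof. by []. Qed.

Lemma wp_rmul r x y : block_wp b l h (updR X r (X x * X y)%R) Q ->
  block_wp (RMul r x y :: b) l h X Q.
Proof. by []. Qed.

Lemma wp_nil : Q l h X -> block_wp [::] l h X Q.
Proof. by []. Qed.

End Steps.

End Runs.

Ltac wp_step :=
  lazymatch goal with
  | |- block_wp (?i :: _) _ _ _ _ =>
    lazymatch i with
    | NConst _ _ => eapply wp_nconst; [cbn [set_nth nth]; reflexivity |]
    | NAdd _ _ _ => eapply wp_nadd; [cbn [set_nth nth]; reflexivity |]
    | NSub _ _ _ => eapply wp_nsub; [cbn [set_nth nth]; reflexivity |]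
    | NLoadI _ _ => eapply wp_nload;
        [cbn [set_nth nth]; reflexivity | cbn [size nth]; try lia |]
    | NStoreI _ _ => eapply wp_nstore;
        [cbn [nth]; reflexivity | cbn [nth]; reflexivity | cbn [size]; try lia |]
    | RLoadI _ _ => eapply wp_rload; [cbn [nth]; reflexivity |]
    | RStoreI _ _ => eapply wp_rstore; [cbn [nth]; reflexivity |]
    | RConst0 _ => apply wp_rconst0
    | RConst1 _ => apply wp_rconst1
    | RAdd _ _ _ => apply wp_radd
    | RSub _ _ _ => apply wp_rsub
    | RMul _ _ _ => apply wp_rmul
    end
  | |- block_wp [::] _ _ _ _ => apply wp_nil
  end.

(** * Moving the matrix out of the low registers *)

Ltac upd := rewrite /updN /updR;
  repeat (match goal with |- context [if ?x == ?y then _ else _] =>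
    case: (eqVneq x y) => ? ; try (exfalso; lia) end).

Ltac eq_regs := congr (split_mem _ _);
  repeat (match goal with |- _ :: _ = _ :: _ => apply: f_equal2 end);
  try reflexivity; try nia.

Section Relocation.
Variable R : realType.
Implicit Types (h f : nat -> nat) (X : nat -> R).

(** Computes [n * n] by repeated addition. *)
Definition square_loop : cmd :=
  Loop (Blk [:: NAdd 2 2 0; NAdd 4 4 6]) 4 0.

Lemma runs_square n c x3 x5 x7 h X : 0 < n ->
  runs square_loop (split_mem [:: n; c; 0; x3; 0; x5; 1; x7] h) X (n * 3)
    (fun N' X' => N' = split_mem [:: n; c; n * n; x3; n; x5; 1; x7] h /\ X' = X).
Proof.
move=> n0.
pose I k (N : nat -> nat) (X' : nat -> R) := k < n /\ X' = X /\
  N = split_mem [:: n; c; (n - k.+1) * n; x3; n - k.+1; x5; 1; x7] h.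
have -> : n * 3 = n.-1.+1 * 2.+1 by rewrite prednK.
apply: (runs_loop (I := I)); last first.
  by rewrite /I prednK // subnn mul0n; split; first lia.
move=> k N {}X' [ltk [-> ->]]; apply: runs_block => //=.
case: k ltk => [|k] ltk; split; try by rewrite /split_mem /=; lia.
  by split=> //; eq_regs.
by split; [lia | split => //; eq_regs].
Qed.

Definition copy_loop : cmd :=
  Loop (Blk [:: NAdd 4 7 3; NLoadI 5 7; NStoreI 4 5; NAdd 7 7 6]) 7 2.

(** Cells below 8 are registers by now, so the copy starts at 8; its targets lie above all its
    sources. The [maxn q 8] is due to the first round, which copies cell 8 even when the matrix ends
    before it. *)
Lemma runs_copy n c q B x4 x5 f X : q < B -> 8 < B ->
  runs copy_loop (split_mem [:: n; c; q.+1; B; x4; x5; 1; 8] f) X (q.+1 * 5)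
    (fun N' X' => exists x4 x5 x7 h, [/\
       N' = split_mem [:: n; c; q.+1; B; x4; x5; 1; x7] h, X' = X &
       forall x, h x = if B + 8 <= x <= B + maxn q 8 then f (x - B) else f x]).
Proof.
move=> qB B8.
pose I k (N : nat -> nat) (X' : nat -> R) := exists x4 x5 a h, [/\
  N = split_mem [:: n; c; q.+1; B; x4; x5; 1; a] h, X' = X, 8 <= a,
  a + k = maxn q 8 &
  forall x, h x = if B + 8 <= x < B + a then f (x - B) else f x].
apply: (@runs_time _ _ _ _ ((maxn q 8 - 8).+1 * 4.+1)).
  by rewrite leq_mul2r; lia.
apply: (runs_loop (I := I)); last first.
  exists x4, x5, 8, f; split=> //; first by lia.
  by move=> x; case: ifP => //; lia.
move=> k N {}X' [y4 [y5 [a [h [-> -> a8 ak hE]]]]]; apply: runs_block => //=.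
split=> //; split; first by lia.
have hE' x : updN h (a + B) (h a) x =
    if B + 8 <= x < B + (a + 1) then f (x - B) else f x.
  rewrite /updN; case: eqP => [->|ne].
    by rewrite hE ifF ?ifT; [congr f; lia | lia | lia].
  by rewrite hE; congr (if _ then _ else _); lia.
case: k ak => [|k] ak; split; try by rewrite /split_mem /=; lia.
  exists (a + B), (h a), (a + 1), (updN h (a + B) (h a)); split=> // x.
  by rewrite hE'; congr (if _ then _ else _); lia.
by exists (a + B), (h a), (a + 1), (updN h (a + B) (h a)); split=> //; lia.
Qed.

(** Splits off the binary digit of weight [w] without division: as the lower digits sum to less than
    [w], the digit is 1 exactly when register 1 is at least [w]. *)
Definition unpack (k w : nat) : cmd :=
  Seq (Blk [:: NConst 4 w; NConst 5 0])
 (Seq (Unless 1 4 (Blk [:: NSub 1 1 4; NConst 5 1]))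
      (Blk [:: NConst 4 k; NAdd 4 4 3; NStoreI 4 5])).

Lemma runs_unpack k w n b r q1 B x4 x5 x7 h X : b <= 1 -> r < w -> 8 <= B ->
  runs (unpack k w) (split_mem [:: n; b * w + r; q1; B; x4; x5; 1; x7] h) X 8
    (fun N' X' => N' = split_mem [:: n; r; q1; B; k + B; b; 1; x7]
       (updN h (k + B) b) /\ X' = X).
Proof.
move=> b1 rw B8; apply: (@runs_block_seq _ _ _ _ _ _ 6) => //=.
apply: (@runs_seq _ _ _ _ _ 3 3); apply: runs_unless; rewrite /split_mem /=.
  move=> lt; have -> : b = 0 by nia.
  by apply: runs_block => //=; split; first lia; split=> //; eq_regs.
move=> le; have -> : b = 1 by nia.
apply: runs_block => //=; apply: runs_block => //=; split; first lia.
by split=> //; eq_regs.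
Qed.

(* Registers 1 to 7 initially hold matrix entries: they are read as the binary
   digits of one number, kept in register 1, which frees registers 2 to 7. *)
Definition pack : seq instr :=
  [:: NAdd 1 1 1; NAdd 1 1 2; NAdd 1 1 1; NAdd 1 1 3; NAdd 1 1 1; NAdd 1 1 4;
      NAdd 1 1 1; NAdd 1 1 5; NAdd 1 1 1; NAdd 1 1 6; NAdd 1 1 1; NAdd 1 1 7;
      NConst 6 1].

(** Address [a] moves to [B + a] with [B = n * n + 16 + n]. The [n * n] puts the [n] cells up to [B]
    beyond the input, so that they are zero; the 16 keeps them clear of the later registers. *)
Definition relocate : cmd :=
  Seq (Blk [:: NConst 2 0; NConst 4 0])
 (Seq square_loop
 (Seq (Blk [:: NConst 5 16; NAdd 3 2 5; NAdd 3 3 0; NAdd 2 2 6; NConst 7 8])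
 (Seq copy_loop
 (Seq (unpack 1 64) (Seq (unpack 2 32) (Seq (unpack 3 16) (Seq (unpack 4 8)
 (Seq (unpack 5 4) (Seq (unpack 6 2) (unpack 7 1)))))))))).

(* The zeros in front of the copy serve as row -1 of the matrix. *)
Lemma runs_relocate n f X : 0 < n ->
  (forall a, 0 < a -> f a <= 1) -> (forall a, n * n < a -> f a = 0) ->
  runs relocate (split_mem [:: n; 64 * f 1 + 32 * f 2 + 16 * f 3 + 8 * f 4 +
      4 * f 5 + 2 * f 6 + f 7; f 2; f 3; f 4; f 5; 1; f 7] f) X
    (63 + n * 3 + (n * n).+1 * 5)
    (fun N' X' => exists x1 x4 x5 x7 h, [/\
       N' = split_mem
         [:: n; x1; (n * n).+1; n * n + 16 + n; x4; x5; 1; x7] h, X' = X &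
       forall x, n * n < x ->
         h x = if n * n + 16 + n < x then f (x - (n * n + 16 + n)) else 0]).
Proof.
move=> n0 f1 f0.
have F k : f k.+1 <= 1 by apply: f1.
apply: (@runs_time _ _ _ _ (2 + (n * 3 + (5 + ((n * n).+1 * 5 + 56)))));
  first by lia.
apply: runs_block_seq => //=.
apply: runs_seq; apply: runs_conseq; first exact: runs_square.
move=> ? ? [-> ->]; apply: runs_block_seq => //=.
set B := n * n + 16 + n.
apply: runs_seq; rewrite addn1.
have qB : n * n < B by rewrite /B; lia.
have B8 : 8 < B by rewrite /B; lia.
apply: runs_conseq; first exact: runs_copy qB B8.
move=> ? ?.
case=> y4 [y5 [y7 [h [-> -> hE]]]].
have U k w b r T c c' y4' y5' h' Q : c = b * w + r -> b <= 1 -> r < w ->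
    runs c' (split_mem [:: n; r; (n * n).+1; B; k + B; b; 1; y7]
       (updN h' (k + B) b)) X T Q ->
    runs (Seq (unpack k w) c')
     (split_mem [:: n; c; (n * n).+1; B; y4'; y5'; 1; y7] h') X (8 + T) Q.
  move=> -> b1 rw H; apply: runs_seq.
  apply: runs_conseq; first exact: runs_unpack b1 rw (ltnW B8).
  by move=> ? ? [-> ->].
have [F1 F2 F3 F4 F5] := And5 (F 0) (F 1) (F 2) (F 3) (F 4).
have [F6 F7] := conj (F 5) (F 6).
apply: (U 1 64 (f 1) (32 * f 2 + 16 * f 3 + 8 * f 4 + 4 * f 5 + 2 * f 6 + f 7) 48);
  [lia | lia | lia |].
apply: (U 2 32 (f 2) (16 * f 3 + 8 * f 4 + 4 * f 5 + 2 * f 6 + f 7) 40);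
  [lia | lia | lia |].
apply: (U 3 16 (f 3) (8 * f 4 + 4 * f 5 + 2 * f 6 + f 7) 32);
  [lia | lia | lia |].
apply: (U 4 8 (f 4) (4 * f 5 + 2 * f 6 + f 7) 24); [lia | lia | lia |].
apply: (U 5 4 (f 5) (2 * f 6 + f 7) 16); [lia | lia | lia |].
apply: (U 6 2 (f 6) (f 7) 8); [lia | lia | lia |].
have e7 : f 7 = f 7 * 1 + 0 by lia.
rewrite {1}e7.
apply: runs_conseq; first exact: runs_unpack (F 6) (ltn0Sn 0) (ltnW B8).
move=> ? ? [-> ->].
set h' := updN _ _ _.
exists 0, (7 + B), (f 7), y7, h'; split=> // x qx; rewrite /h' /updN.
do 7! (case: eqP => [->|?]; first by rewrite ifT ?addnK //; lia).
rewrite hE; case: ifP => [/andP[le1 le2]|nle]; first by rewrite ifT //; lia.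
(* Nothing was written to [x]; every input cell involved here lies beyond the matrix and holds 0. *)
case: ltnP => Bx; last by apply: f0.
by rewrite !f0 //; lia.
Qed.

End Relocation.

(** * Listing the nonzero second differences *)

Definition row_entries (A : nat -> nat -> nat) (i m : nat) : seq (nat * nat * nat) :=
  [seq (i, j, corner A i j) | j <- iota 0 m & corner A i j != 2].

Definition entries (A : nat -> nat -> nat) (n m : nat) : seq (nat * nat * nat) :=
  flatten [seq row_entries A i n | i <- iota 0 m].

Definition stored (h : nat -> nat) (a : nat) (es : seq (nat * nat * nat)) : Prop :=
  forall t, t < size es -> let e := nth (0, 0, 0) es t in
  [/\ h (a + 3 * t) = e.1.1, h (a + 3 * t + 1) = e.1.2 & h (a + 3 * t + 2) = e.2].

Lemma row_entriesS A i m : row_entries A i m.+1 =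
  row_entries A i m ++ (if corner A i m != 2 then [:: (i, m, corner A i m)] else [::]).
Proof.
rewrite /row_entries -[m.+1]addn1 iotaD filter_cat map_cat /= add0n.
by case: (_ != 2).
Qed.

Lemma entriesS A n m : entries A n m.+1 = entries A n m ++ row_entries A m n.
Proof.
by rewrite /entries -[m.+1]addn1 iotaD map_cat flatten_cat /= cats0 add0n.
Qed.

Lemma stored_write h a es i j c (s := a + 3 * size es) :
  stored h a es ->
  stored (updN (updN (updN h s i) (s + 1) j) (s + 1 + 1) c) a (rcons es (i, j, c)).
Proof.
move=> st t; rewrite size_rcons ltnS leq_eqVlt nth_rcons => /orP[/eqP->|lt].
  rewrite ltnn eqxx /=; rewrite /s; split; upd; rewrite //; exfalso; lia.
rewrite lt /=; have [h1 h2 h3] := st t lt.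
by rewrite /s; split; upd.
Qed.

Lemma stored_cat h a es1 es2 : stored h a (es1 ++ es2) -> stored h a es1.
Proof.
move=> st t lt; have := st t; rewrite size_cat nth_cat lt.
by apply; rewrite ltn_addr.
Qed.

Section Scan.
Variable R : realType.
Implicit Types (h g : nat -> nat) (X : nat -> R).

(* Each triple is written unconditionally at the end of the list; the end
   pointer, register 1, only moves past it when the difference is nonzero. *)
Definition scan_row : cmd :=
  Loop (Seq (Blk [:: NLoadI 9 3; NLoadI 10 4;
                     NAdd 11 9 8; NAdd 11 11 13; NAdd 12 10 7; NSub 11 11 12;
                     NStoreI 1 2; NAdd 12 1 6; NStoreI 12 5; NAdd 12 12 6;
                     NStoreI 12 11;
                     NSub 12 11 13; NSub 8 13 11; NAdd 12 12 8;
                     NConst 8 0; NAdd 7 9 8; NAdd 8 10 8;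
                     NAdd 3 3 6; NAdd 4 4 6; NAdd 5 5 6])
            (Unless 12 6 (Blk [:: NAdd 1 1 15]))) 5 0.

(** [lp] is the end of the list and [a] its start, [cp] and [up] point into the current row and the
    row above, and [pc], [pu] are the entries of these rows in the preceding column. *)
Definition scan_regs (n lp i cp up j pc pu x9 x10 x11 x12 a : nat) : seq nat :=
  [:: n; lp; i; cp; up; j; 1; pc; pu; x9; x10; x11; x12; 2; a; 3].

Variables (A : nat -> nat -> nat) (n a0 a : nat) (g : nat -> nat).
Hypotheses (n_gt0 : 0 < n)
  (A_col0 : forall i, A i 0 = 0)
  (gA : forall i j, i <= n -> j < n -> g (a0 + i * n + j) = A i j.+1)
  (a0_ge : 16 <= a0) (a_ge : a0 + n.+1 * n <= a).

Lemma runs_scan_row i es x9 x10 x11 x12 h X : i < n ->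
  (forall x, x < a -> h x = g x) -> stored h a es ->
  runs scan_row
    (split_mem (scan_regs n (a + 3 * size es) i (a0 + i.+1 * n) (a0 + i * n) 0
       0 0 x9 x10 x11 x12 a) h) X (n * 23)
    (fun N' X' => exists es' x7 x8 x9 x10 x11 x12 h', [/\
      es' = es ++ row_entries A i n,
      N' = split_mem (scan_regs n (a + 3 * size es') i (a0 + i.+1 * n + n)
        (a0 + i * n + n) n x7 x8 x9 x10 x11 x12 a) h',
      X' = X, forall x, x < a -> h' x = g x & stored h' a es']).
Proof.
move=> ltin hg st.
pose I k (N : nat -> nat) (X' : nat -> R) :=
  exists j es' x9 x10 x11 x12 h', [/\ j + k.+1 = n,
      es' = es ++ row_entries A i j,
      N = split_mem (scan_regs n (a + 3 * size es') i (a0 + i.+1 * n + j)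
        (a0 + i * n + j) j (A i.+1 j) (A i j) x9 x10 x11 x12 a) h' /\ X' = X,
      forall x, x < a -> h' x = g x & stored h' a es'].
have -> : n * 23 = n.-1.+1 * 22.+1 by rewrite prednK.
apply: (runs_loop (I := I)); last first.
  (* Column -1 is not stored in memory: the two remembered entries just start as 0. *)
  exists 0, es, x9, x10, x11, x12, h; rewrite !A_col0 !addn0 cats0 prednK //.
move=> k N {}X' [j [es' [y9 [y10 [y11 [y12 [h' [jk es'E [-> ->] hg' st']]]]]]]].
have jn : j < n by lia.
have lei : i.+1 * n <= n * n by rewrite leq_mul2r ltin orbT.
have cp_lt : a0 + i.+1 * n + j < a by lia.
have up_lt : a0 + i * n + j < a by lia.
apply: (@runs_block_seq _ _ _ _ _ _ 2); first by [].
rewrite /scan_regs; repeat wp_step.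
rewrite !hg' // !gA //; last by lia.
rewrite -/(corner A i j) !addn0.
set s := a + 3 * size es'.
set c := corner A i j.
set h1 := updN _ (s + 1 + 1) c.
have hg1 x : x < a -> h1 x = g x.
  by move=> xa; rewrite -hg' // /h1 /s; upd.
have st1 : stored h1 a (rcons es' (i, j, c)) by apply: stored_write.
(* The triple just written can be ignored: a list is delimited by its end pointer alone. *)
have st0 : stored h1 a es' by move: st1; rewrite -cats1 => /stored_cat.
(* Register 12 holds [(c - 2) + (2 - c)] with truncated subtractions, which is below 1 exactly when
   [c = 2]. *)
apply: runs_unless => c2.
  have c2' : c = 2 by move: c2; rewrite /split_mem /=; lia.
  have eS : es' = es ++ row_entries A i j.+1.
    by rewrite row_entriesS -/c c2' eqxx /= cats0.
  case: k jk => [|k] jk; split; try by rewrite /split_mem /=; lia.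
    have jn' : j + 1 = n by lia.
    exists es'; do 7 eexists.
    split; [by rewrite eS -(addn1 j) jn' | | by [] | exact: hg1 | exact: st0].
    by rewrite /scan_regs -!(addnA _ j) jn'; reflexivity.
  exists j.+1, es'; do 5 eexists; split; [by lia | exact: eS | | exact: hg1 | exact: st0].
  by split=> //; rewrite /scan_regs !addn1 !addnS; reflexivity.
have c2' : c != 2 by move: c2; rewrite /split_mem /=; lia.
have eS : rcons es' (i, j, c) = es ++ row_entries A i j.+1.
  by rewrite row_entriesS -/c c2' -cats1 es'E catA.
have sS : s + 3 = a + 3 * size (rcons es' (i, j, c)) by rewrite size_rcons /s; lia.
apply: runs_block => //=; rewrite sS.
case: k jk => [|k] jk; split; try by rewrite /split_mem /=; lia.
  have jn' : j + 1 = n by lia.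
  exists (rcons es' (i, j, c)); do 7 eexists.
  split; [by rewrite eS -(addn1 j) jn' | | by [] | exact: hg1 | exact: st1].
  by rewrite /scan_regs -!(addnA _ j) jn'; reflexivity.
exists j.+1, (rcons es' (i, j, c)); do 5 eexists.
split; [by lia | exact: eS | | exact: hg1 | exact: st1].
by split=> //; rewrite /scan_regs !addn1 !addnS; reflexivity.
Qed.

Definition scan : cmd :=
  Loop (Seq (Blk [:: NConst 5 0; NConst 7 0; NConst 8 0])
       (Seq scan_row (Blk [:: NAdd 2 2 6]))) 2 0.

(** Rows are adjacent in memory, so the row pointers end where the next row starts and need no
    reset. *)
Lemma runs_scan x5 x7 x8 x9 x10 x11 x12 X :
  runs scan (split_mem (scan_regs n a 0 (a0 + n) a0 x5 x7 x8 x9 x10 x11 x12 a) g) X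
    (n * (n * 23 + 5))
    (fun N' X' => exists x2 x3 x4 x5 x7 x8 x9 x10 x11 x12 h', [/\
      N' = split_mem (scan_regs n (a + 3 * size (entries A n n)) x2 x3 x4 x5
        x7 x8 x9 x10 x11 x12 a) h',
      X' = X & stored h' a (entries A n n)]).
Proof.
pose I k (N : nat -> nat) (X' : nat -> R) :=
  exists i x5 x7 x8 x9 x10 x11 x12 h', [/\ i + k.+1 = n,
      N = split_mem (scan_regs n (a + 3 * size (entries A n i)) i (a0 + i.+1 * n)
        (a0 + i * n) x5 x7 x8 x9 x10 x11 x12 a) h', X' = X,
      forall x, x < a -> h' x = g x & stored h' a (entries A n i)].
have -> : n * (n * 23 + 5) = n.-1.+1 * (3 + (n * 23 + 1)).+1 by rewrite prednK //; lia.
apply: (runs_loop (I := I)); last first.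
  by exists 0, x5, x7, x8, x9, x10, x11, x12, g; split=> //;
    rewrite ?prednK // mul1n mul0n !addn0.
move=> k N {}X' [i [y5 [y7 [y8 [y9 [y10 [y11 [y12 [h [ik -> -> hg st]]]]]]]]]].
apply: runs_block_seq => //=; apply: runs_seq.
apply: runs_conseq; first by apply: runs_scan_row hg st; lia.
move=> ? ? [es' [z7 [z8 [z9 [z10 [z11 [z12 [h' [-> -> -> hg' st']]]]]]]]].
apply: runs_block => //=; rewrite -entriesS in st' *.
case: k ik => [|k] ik; split; try by rewrite /split_mem /=; lia.
  have iE : i.+1 = n by lia.
  by rewrite iE in st' *; do 11 eexists; split; [reflexivity | | exact: st'].
exists i.+1; do 8 eexists; split; [by lia | | by [] | exact: hg' | exact: st'].
by rewrite /scan_regs addn1 -!addnA -!mulSnr; reflexivity.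
Qed.

End Scan.

(** * The three passes of a query *)

Section Query.
Variable R : realType.
Variable n : nat.
Hypothesis n_gt0 : 0 < n.
Implicit Types (h : nat -> nat) (X v u w z : nat -> R).

(* The real memory is laid out as follows: the working copy of the vector at
   2 + n, the result at 2 + n + n, the coefficients -2, ..., 2 at 2 + n + n + n;
   real registers 0 and 1 are scratch. *)
Definition query_regs (e j x8 x9 x10 x11 x12 x13 p x15 : nat) : seq nat :=
  [:: n; e; 2 + n; 2 + n + n; 2 + n + n + n; j; 1; 0; x8; x9; x10; x11; x12; x13;
      p; x15].

Definition copy_in : cmd :=
  Loop (Blk [:: NAdd 8 2 5; RLoadI 0 5; RStoreI 8 0; NAdd 5 5 6]) 5 0.

(** Real register 0 is scratch and also holds entry 0 of [v]; ascending order reads that entry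
    before it is overwritten. *)
Lemma runs_copy_in v e x8 x9 x10 x11 x12 x13 p x15 h X :
  (forall m, m < n -> X m = v m) -> (forall x, n <= x -> X x = 0%R) ->
  runs copy_in (split_mem (query_regs e 0 x8 x9 x10 x11 x12 x13 p x15) h) X (n * 5)
    (fun N' X' => exists x8, [/\
       N' = split_mem (query_regs e n x8 x9 x10 x11 x12 x13 p x15) h,
       forall m, m < n -> X' (2 + n + m) = v m &
       forall x, 2 + n + n <= x -> X' x = 0%R]).
Proof.
move=> Xv X0.
pose I k (N : nat -> nat) (X' : nat -> R) := exists j x8, [/\ j + k.+1 = n,
  N = split_mem (query_regs e j x8 x9 x10 x11 x12 x13 p x15) h,
  forall m, m < j -> X' (2 + n + m) = v m,
  forall m, j <= m < n -> X' m = v m &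
  forall x, 2 + n + n <= x -> X' x = 0%R].
have -> : n * 5 = n.-1.+1 * 4.+1 by rewrite prednK.
apply: (runs_loop (I := I)); last first.
  exists 0, x8; split=> //; first by lia.
  by move=> x lx; apply: X0; lia.
move=> k N X' [j [y8 [jk -> XV Xj XO]]].
apply: runs_block; [by [] | by [] | rewrite /query_regs; repeat wp_step].
set X1 := updR _ _ _.
have XV1 m : m < j + 1 -> X1 (2 + n + m) = v m.
  rewrite /X1 => lm; upd; last by apply: XV; lia.
  by have -> : m = j by [lia]; apply: Xj; lia.
have Xj1 m : j + 1 <= m < n -> X1 m = v m.
  by rewrite /X1 => lm; upd; apply: Xj; lia.
have XO1 x : 2 + n + n <= x -> X1 x = 0%R.
  by rewrite /X1 => lm; upd; apply: XO; lia.
case: k jk => [|k] jk; split; try by rewrite /split_mem /=; lia.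
  by exists (2 + n + j); rewrite jk in XV1 *; split.
by exists (j + 1), (2 + n + j); split=> //; lia.
Qed.

Definition suffix_sums : cmd :=
  Loop (Blk [:: NSub 5 5 6; NAdd 8 2 5; RLoadI 0 8; RAdd 1 1 0; RStoreI 8 1]) 7 5.

Lemma runs_suffix_sums v e x8 x9 x10 x11 x12 x13 p x15 h X :
  X 1 = 0%R -> (forall m, m < n -> X (2 + n + m) = v m) ->
  (forall x, 2 + n + n <= x -> X x = 0%R) ->
  runs suffix_sums
    (split_mem (query_regs e n x8 x9 x10 x11 x12 x13 p x15) h) X (n * 6)
    (fun N' X' => exists x8, [/\
       N' = split_mem (query_regs e 0 x8 x9 x10 x11 x12 x13 p x15) h,
       forall m, m < n -> X' (2 + n + m) = (\sum_(m <= t < n) v t)%R &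
       forall x, 2 + n + n <= x -> X' x = 0%R]).
Proof.
move=> X1 XV XO.
pose I k (N : nat -> nat) (X' : nat -> R) := exists x8, [/\ k < n,
  N = split_mem (query_regs e k.+1 x8 x9 x10 x11 x12 x13 p x15) h,
  X' 1 = (\sum_(k.+1 <= t < n) v t)%R,
  forall m, m < n -> X' (2 + n + m) =
    if m <= k then v m else (\sum_(m <= t < n) v t)%R &
  forall x, 2 + n + n <= x -> X' x = 0%R].
have -> : n * 6 = n.-1.+1 * 5.+1 by rewrite prednK.
apply: (runs_loop (I := I)); last first.
  exists x8; split=> //; rewrite ?prednK //; first by rewrite big_geq.
  by move=> m lm; rewrite XV // ifT //; lia.
move=> k N X' [y8 [kn -> X1' XV' XO']].
apply: runs_block; [by [] | by [] | rewrite /query_regs; repeat wp_step].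
rewrite subn1 [k.+1.-1]/=; set X2 := updR _ _ _.
have sk : (\sum_(k <= t < n) v t = \sum_(k.+1 <= t < n) v t + v k)%R.
  by rewrite big_ltn // addrC.
have X21 : X2 1 = (\sum_(k <= t < n) v t)%R.
  by rewrite /X2; upd; rewrite X1' XV' // leqnn sk.
have XV2 m : m < n -> X2 (2 + n + m) =
    if m < k then v m else (\sum_(m <= t < n) v t)%R.
  rewrite /X2 => lm; upd.
    have -> : m = k by [lia].
    by rewrite ltnn X1' XV' // leqnn sk.
  by rewrite XV'; [congr (if _ then _ else _); lia | lia].
have XO2 x : 2 + n + n <= x -> X2 x = 0%R.
  by rewrite /X2 => lm; upd; apply: XO'; lia.
case: k kn {X1' XV' sk} @X2 X21 XV2 XO2 => [|k] kn X2 X21 XV2 XO2; split;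
  try by rewrite /split_mem /=; lia.
  by exists (2 + n + 0).
by exists (2 + n + k.+1); split=> //; lia.
Qed.

(** The table by which [sparse_product] converts the stored natural [c] into the scalar [c - 2]. *)
Definition coefficients : cmd :=
  Seq (Blk [:: RConst0 1; RConst1 0; RSub 1 1 0; RSub 1 1 0;
               NConst 9 5; NAdd 9 4 9; NAdd 8 4 7])
      (Loop (Blk [:: RStoreI 8 1; RAdd 1 1 0; NAdd 8 8 6]) 8 9).

Lemma runs_coefficients w e j x8 x9 x10 x11 x12 x13 p x15 h X :
  (forall m, m < n -> X (2 + n + m) = w m) ->
  (forall x, 2 + n + n <= x -> X x = 0%R) ->
  runs coefficients
    (split_mem (query_regs e j x8 x9 x10 x11 x12 x13 p x15) h) X 27
    (fun N' X' => exists x8 x9, [/\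
       N' = split_mem (query_regs e j x8 x9 x10 x11 x12 x13 p x15) h,
       forall m, m < n -> X' (2 + n + m) = w m,
       forall m, m < n -> X' (2 + n + n + m) = 0%R &
       forall c, c <= 4 -> X' (2 + n + n + n + c) = (c%:R - 2)%R]).
Proof.
move=> XV XO; apply: (@runs_block_seq _ _ _ _ _ _ (4.+1 * 3.+1)); first by [].
rewrite /query_regs; repeat wp_step.
pose I k (N : nat -> nat) (X' : nat -> R) := exists c, [/\ c + k = 4,
  N = split_mem (query_regs e j (2 + n + n + n + c) (2 + n + n + n + 5)
        x10 x11 x12 x13 p x15) h,
  X' 0 = 1%R /\ X' 1 = (c%:R - 2)%R,
  forall x, 1 < x < 2 + n + n + n -> X' x = X x &
  forall c', c' < c -> X' (2 + n + n + n + c') = (c'%:R - 2)%R].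
apply: (runs_loop (I := I)); last first.
  exists 0; split=> //; first by split; upd; ring.
  by move=> x lx; upd.
move=> k N X' [c [ck -> [X0 X1] XX XT]].
apply: runs_block; [by [] | by [] | rewrite /query_regs; repeat wp_step].
set X2 := updR _ _ _.
have [X20 X21] : X2 0 = 1%R /\ X2 1 = ((c + 1)%:R - 2)%R.
  by rewrite /X2; split; upd => //; rewrite X0 X1 natrD; ring.
have XX2 x : 1 < x < 2 + n + n + n -> X2 x = X x.
  by rewrite /X2 => lx; upd; apply: XX.
have XT2 c' : c' < c + 1 -> X2 (2 + n + n + n + c') = (c'%:R - 2)%R.
  rewrite /X2 => lc; upd; last by apply: XT; lia.
  by have -> : c' = c by [lia]; apply: X1.
case: k ck => [|k] ck; split; try by rewrite /split_mem /=; lia.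
  exists (2 + n + n + n + c + 1), (2 + n + n + n + 5); split=> //.
  - by move=> m lm; rewrite XX2 ?XV //; lia.
  - by move=> m lm; rewrite XX2 ?XO //; lia.
  - by move=> c' lc; apply: XT2; lia.
by exists (c + 1); split=> //; [lia | rewrite addnA].
Qed.

Definition entry_dst (swap : bool) (e : nat * nat * nat) : nat :=
  if swap then e.1.2 else e.1.1.
Definition entry_src (swap : bool) (e : nat * nat * nat) : nat :=
  if swap then e.1.1 else e.1.2.

Definition sparse_product (swap : bool) : cmd :=
  Loop (Blk [:: NLoadI 8 14; NAdd 14 14 6; NLoadI 9 14; NAdd 14 14 6;
                NLoadI 10 14; NAdd 14 14 6;
                NAdd 11 3 (if swap then 9 else 8);
                NAdd 12 2 (if swap then 8 else 9); NAdd 10 10 4;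
                RLoadI 0 12; RLoadI 1 10; RMul 0 0 1; RLoadI 1 11; RAdd 0 0 1;
                RStoreI 11 0]) 14 1.

Lemma runs_sparse_product swap w (es : seq (nat * nat * nat)) a
    j x8 x9 x10 x11 x12 x13 x15 h X :
  0 < size es -> 16 <= a -> stored h a es ->
  (forall e, e \in es -> [/\ e.1.1 < n, e.1.2 < n & e.2 <= 4]) ->
  (forall m, m < n -> X (2 + n + m) = w m) ->
  (forall m, m < n -> X (2 + n + n + m) = 0%R) ->
  (forall c, c <= 4 -> X (2 + n + n + n + c) = (c%:R - 2)%R) ->
  runs (sparse_product swap)
    (split_mem (query_regs (a + 3 * size es) j x8 x9 x10 x11 x12 x13 a x15) h) X
    (size es * 16)
    (fun N' X' => exists x8 x9 x10 x11 x12,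
       N' = split_mem (query_regs (a + 3 * size es) j x8 x9 x10 x11 x12 x13
              (a + 3 * size es) x15) h /\
       forall m, m < n -> X' (2 + n + n + m) =
         (\sum_(e <- es | entry_dst swap e == m)
            (e.2%:R - 2) * w (entry_src swap e))%R).
Proof.
move=> es0 a16 st bnd XV XO XT.
pose I k (N : nat -> nat) (X' : nat -> R) := exists t x8 x9 x10 x11 x12,
  [/\ t + k.+1 = size es,
   N = split_mem (query_regs (a + 3 * size es) j x8 x9 x10 x11 x12 x13
         (a + 3 * t) x15) h,
   forall m, m < n -> X' (2 + n + m) = w m,
   forall c, c <= 4 -> X' (2 + n + n + n + c) = (c%:R - 2)%R &
   forall m, m < n -> X' (2 + n + n + m) =
     (\sum_(e <- take t es | entry_dst swap e == m)
        (e.2%:R - 2) * w (entry_src swap e))%R].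
have -> : size es * 16 = (size es).-1.+1 * 15.+1 by rewrite prednK.
apply: (runs_loop (I := I)); last first.
  exists 0, x8, x9, x10, x11, x12; split=> //; first by lia.
    by rewrite muln0 addn0.
  by move=> m lm; rewrite take0 big_nil XO.
move=> k N X' [t [y8 [y9 [y10 [y11 [y12 [tk -> XV' XT' XO']]]]]]].
have lt : t < size es by lia.
have [h1 h2 h3] := st t lt.
set d := nth (0, 0, 0) es t in h1 h2 h3.
have [di dj dc] := bnd _ (mem_nth (0, 0, 0) lt); rewrite -/d in di dj dc.
have [dd ds] : entry_dst swap d < n /\ entry_src swap d < n.
  by rewrite /entry_dst /entry_src; case: ifP.
have tS : take t.+1 es = rcons (take t es) d by rewrite (take_nth (0, 0, 0)).
pose Y (X2 : nat -> R) := [/\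
  forall m, m < n -> X2 (2 + n + m) = w m,
  forall c, c <= 4 -> X2 (2 + n + n + n + c) = (c%:R - 2)%R &
  forall m, m < n -> X2 (2 + n + n + m) =
    (\sum_(e <- take t.+1 es | entry_dst swap e == m)
       (e.2%:R - 2) * w (entry_src swap e))%R].
(* What both values of [swap] have in common: above the scratch registers, one round changes one
   cell only. *)
have YE (X2 : nat -> R) : (forall x, 1 < x -> X2 x =
    if x == 2 + n + n + entry_dst swap d then
    (X' (2 + n + entry_src swap d)%N * X' (d.2 + (2 + n + n + n))%N + X' x)%R
    else X' x) -> Y X2.
  move=> XE; split=> [m lm|c lc|m lm]; rewrite XE //.
  - by rewrite ifF ?XV' //; lia.
  - by rewrite ifF ?XT' //; lia.
  rewrite (XV' _ ds) (addnC d.2) (XT' _ dc) (XO' _ lm).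
  rewrite tS -cats1 big_cat big_cons big_nil eqn_add2l [m == _]eq_sym.
  case: ifP => _; rewrite /= addr0 //.
  by rewrite addrC mulrC.
apply: (@runs_conseq _ _ _ _ _ (fun N' X' => (exists x8 x9 x10 x11 x12,
   N' = split_mem (query_regs (a + 3 * size es) j x8 x9 x10 x11 x12 x13
         (a + 3 * t.+1) x15) h) /\ Y X')).
  have ap : a + 3 * t + 1 + 1 + 1 = a + 3 * t.+1 by lia.
  have ap2 : a + 3 * t + 1 + 1 = a + 3 * t + 2 by lia.
  apply: runs_block; [by case Es: swap | by [] |].
  move: YE dd ds; rewrite /query_regs /entry_dst /entry_src.
  case Es: swap => YE dd ds; repeat wp_step; rewrite ?ap ?ap2 ?h1 ?h2 ?h3.
    split; first by do 5 eexists; reflexivity.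
    by apply: YE => x x1; upd => //; congr (_ + X' _)%R; lia.
  split; first by do 5 eexists; reflexivity.
  by apply: YE => x x1; upd => //; congr (_ + X' _)%R; lia.
move=> N' X2 [[z8 [z9 [z10 [z11 [z12 ->]]]]] [XV2 XT2 XO2]].
case: k tk => [|k] tk; split; try by rewrite /split_mem /=; lia.
  have tE : t.+1 = size es by lia.
  by rewrite tE take_size in XO2 *; exists z8, z9, z10, z11, z12.
by exists t.+1, z8, z9, z10, z11, z12; split=> //; lia.
Qed.

Definition prefix_sums : cmd :=
  Loop (Blk [:: NAdd 8 3 5; RLoadI 0 8; RAdd 1 1 0; RStoreI 8 1; NAdd 5 5 6]) 5 0.

Lemma runs_prefix_sums u e x8 x9 x10 x11 x12 x13 p x15 h X :
  X 1 = 0%R -> (forall m, m < n -> X (2 + n + n + m) = u m) ->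
  runs prefix_sums
    (split_mem (query_regs e 0 x8 x9 x10 x11 x12 x13 p x15) h) X (n * 6)
    (fun N' X' => exists x8,
       N' = split_mem (query_regs e n x8 x9 x10 x11 x12 x13 p x15) h /\
       forall m, m < n -> X' (2 + n + n + m) = (\sum_(0 <= t < m.+1) u t)%R).
Proof.
move=> X1 XO.
pose I k (N : nat -> nat) (X' : nat -> R) := exists j x8, [/\ j + k.+1 = n,
  N = split_mem (query_regs e j x8 x9 x10 x11 x12 x13 p x15) h,
  X' 1 = (\sum_(0 <= t < j) u t)%R &
  forall m, m < n -> X' (2 + n + n + m) =
    if m < j then (\sum_(0 <= t < m.+1) u t)%R else u m].
have -> : n * 6 = n.-1.+1 * 5.+1 by rewrite prednK.
apply: (runs_loop (I := I)); last first.
  by exists 0, x8; split=> //; [lia | rewrite big_geq].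
move=> k N X' [j [y8 [jk -> X1' XO']]].
have jn : j < n by lia.
apply: runs_block; [by [] | by [] | rewrite /query_regs; repeat wp_step].
set X2 := updR _ _ _; rewrite addn1.
have X21 : X2 1 = (\sum_(0 <= t < j.+1) u t)%R.
  by rewrite /X2; upd; rewrite X1' XO' // ltnn big_nat_recr.
have XO2 m : m < n -> X2 (2 + n + n + m) =
    if m < j.+1 then (\sum_(0 <= t < m.+1) u t)%R else u m.
  rewrite /X2 => lm; upd.
    have -> : m = j by [lia].
    by rewrite ltnSn X1' XO' // ltnn [RHS]big_nat_recr.
  by rewrite XO' //; congr (if _ then _ else _); lia.
case: k jk => [|k] jk; split; try by rewrite /split_mem /=; lia.
  have jE : j.+1 = n by lia.
  rewrite jE in XO2 *; exists (2 + n + n + j); split=> // m lm.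
  by rewrite XO2 // lm.
by exists j.+1, (2 + n + n + j); split=> //; lia.
Qed.

Definition copy_out : cmd :=
  Loop (Blk [:: NSub 5 5 6; NAdd 8 3 5; RLoadI 0 8; RStoreI 5 0]) 7 5.

(** Descending order, so that entry 0 of the result reaches the scratch register 0 in the last
    round. *)
Lemma runs_copy_out z e x8 x9 x10 x11 x12 x13 p x15 h X :
  (forall m, m < n -> X (2 + n + n + m) = z m) ->
  runs copy_out
    (split_mem (query_regs e n x8 x9 x10 x11 x12 x13 p x15) h) X (n * 5)
    (fun N' X' => forall m, m < n -> X' m = z m).
Proof.
move=> XO.
pose I k (N : nat -> nat) (X' : nat -> R) := exists x8, [/\ k < n,
  N = split_mem (query_regs e k.+1 x8 x9 x10 x11 x12 x13 p x15) h,
  forall m, m < n -> X' (2 + n + n + m) = z m &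
  forall m, k < m < n -> X' m = z m].
have -> : n * 5 = n.-1.+1 * 4.+1 by rewrite prednK.
apply: (runs_loop (I := I)); last first.
  by exists x8; split=> //; rewrite ?prednK // => m lm; exfalso; lia.
move=> k N X' [y8 [kn -> XO' Xz]].
apply: runs_block; [by [] | by [] | rewrite /query_regs; repeat wp_step].
rewrite subn1 [k.+1.-1]/=; set X2 := updR _ _ _.
have XO2 m : m < n -> X2 (2 + n + n + m) = z m.
  by rewrite /X2 => lm; upd; apply: XO'.
have Xz2 m : k <= m < n -> X2 m = z m.
  rewrite /X2 => lm; upd; last by apply: Xz; lia.
  by have -> : m = k by [lia]; apply: XO'.
case: k kn {Xz} @X2 XO2 Xz2 => [|k] kn X2 XO2 Xz2; split;
  try by rewrite /split_mem /=; lia.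
  by move=> m lm; apply: Xz2.
by exists (2 + n + n + k.+1); split=> //; lia.
Qed.

End Query.

(** * The programs *)

Section Input.
Variables (R : realType) (n : nat) (M : 'M[bool]_n).
Let f : nat -> nat := nmem (matrix_input R M).

Lemma matrix_input_entry (i j : 'I_n) : f (1 + i * n + j) = M i j.
Proof.
rewrite /f /= (bigD1 i) //= [X in _ + X]big1 => [|i' ne].
  rewrite addn0 (bigD1 j) //= eqxx mul1n [X in _ + X]big1 ?addn0 // => j' ne.
  rewrite eqn_add2l; case: eqP => // e; case/eqP: ne; exact/val_inj/esym.
rewrite big1 // => j' _; case: eqP => // e; case/eqP: ne; apply: val_inj => /=.
by have := ltn_ord j; have := ltn_ord j'; nia.
Qed.

Lemma matrix_input_out a : n * n < a -> f a = 0.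
Proof.
move=> lt; rewrite /f /=; case: a lt => // a lt /=.
rewrite big1 // => i _; rewrite big1 // => j _; case: eqP => // e.
by have := ltn_ord i; have := ltn_ord j; nia.
Qed.

Lemma matrix_input_le1 a : 0 < a -> f a <= 1.
Proof.
move=> a0; case: (ltnP (n * n) a) => [/matrix_input_out -> //|le].
have n0 : 0 < n by nia.
have lti : a.-1 %/ n < n by rewrite ltn_divLR //; lia.
have ltj : a.-1 %% n < n by rewrite ltn_mod.
have -> : a = 1 + Ordinal lti * n + Ordinal ltj.
  by rewrite /= -addnA -divn_eq; lia.
by rewrite matrix_input_entry; case: (M _ _).
Qed.

Lemma matrix_input_pad i j : i < n -> j < n -> f (1 + i * n + j) = pad M i.+1 j.+1.
Proof.
move=> li lj.
by rewrite (padS M (Ordinal li) (Ordinal lj)) -matrix_input_entry.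
Qed.

End Input.

(** The guard against [n = 0] compares with the constant 1, and only after [pack] is a register free
    to hold it. The list starts right behind the copy. *)
Definition preprocess : cmd :=
  Seq (Blk pack) (Unless 0 6 (Seq relocate
 (Seq (Blk [:: NAdd 14 3 2; NAdd 1 3 2; NAdd 3 3 6; NSub 4 3 0; NConst 2 0;
               NConst 13 2; NConst 15 3]) scan))).

Definition preprocessed n (es : seq (nat * nat * nat)) (N : nat -> nat) : Prop :=
  N 0 = n /\ (0 < n ->
    exists x2 x3 x4 x5 x7 x8 x9 x10 x11 x12 a h, [/\ 16 <= a,
      N = split_mem (scan_regs n (a + 3 * size es) x2 x3 x4 x5
        x7 x8 x9 x10 x11 x12 a) h & stored h a es]).

Lemma runs_preprocess (R : realType) n (M : 'M[bool]_n) :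
  runs preprocess (nmem (matrix_input R M)) (fun _ => 0%R : R)
    (84 + n * 3 + (n * n).+1 * 5 + n * (n * 23 + 5))
    (fun N' X' => preprocessed n (entries (pad M) n n) N' /\ X' = (fun _ => 0%R)).
Proof.
set f := nmem _.
apply: (@runs_time _ _ _ _ (13 + ((63 + n * 3 + (n * n).+1 * 5) +
  (7 + n * (n * 23 + 5))).+1)); first by lia.
have f0 : f 0 = n by [].
have fS : f = split_mem (mkseq f 8) f by rewrite split_mem_mkseq.
rewrite {1}fS {fS} /mkseq [iota 0 8]/= [map f _]/=.
apply: runs_block_seq; first by [].
rewrite /pack; repeat wp_step; rewrite f0.
apply: runs_unless => [lt|n0].
  have {}n0 : n = 0 by move: lt; rewrite /split_mem /=; lia.
  by split=> //; split=> [//|n1]; exfalso; lia.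
have {}n0 : 0 < n by [].
apply: runs_seq.
have := @runs_relocate R n f (fun _ => 0%R) n0 (@matrix_input_le1 R n M)
  (@matrix_input_out R n M).
(* [pack] doubles and adds; [code] is the expansion in powers of two. *)
set code := (64 * f 1 + _ + _ + _ + _ + _ + _).
set code' := (_ + _ + f 7).
have -> : code' = code by rewrite /code' /code; lia.
move=> H; apply: runs_conseq; first exact: H.
move=> ? ? [x1 [x4 [x5 [x7 [h [-> -> hE]]]]]].
rewrite (split_mem_extend _ _ 8) /mkseq [iota 0 8]/= [map _ _]/= [_ ++ _]/=.
apply: runs_block_seq; first by [].
repeat wp_step.
set l := (X in split_mem X h).
have -> : l = scan_regs n (n * n + 16 + n + (n * n).+1) 0 (n * n + 17 + n) (n * n + 17)
    x5 x7 (h 8) (h 9) (h 10) (h 11) (h 12) (n * n + 16 + n + (n * n).+1).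
  rewrite /l /scan_regs; repeat (apply: f_equal2; [by lia|]); reflexivity.
apply: runs_conseq; first apply: (@runs_scan R (pad M)) => //.
- by case.
- move=> i j li lj; rewrite hE; last by lia.
  (* Row 0 of the padded matrix is the gap of zeros, row [i.+1] is row [i] of the copy. *)
  case: i li => [|i] li; first by rewrite ifF //=; lia.
  rewrite ifT; last by rewrite mulSn; lia.
  rewrite -(matrix_input_pad R) // -/f; congr f; rewrite mulSn; lia.
- by lia.
- by rewrite mulSn; lia.
move=> ? ? [y2 [y3 [y4 [y5 [y7 [y8 [y9 [y10 [y11 [y12 [h' [-> -> st]]]]]]]]]]]].
split=> //; split=> // _.
exists y2, y3, y4, y5, y7, y8, y9, y10, y11, y12.
by exists (n * n + 16 + n + (n * n).+1), h'; split=> //; lia.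
Qed.

Definition query (swap : bool) : cmd :=
  Seq (Blk [:: NConst 6 1]) (Unless 0 6
 (Seq (Blk [:: NConst 2 2; NAdd 2 2 0; NAdd 3 2 0; NAdd 4 3 0; NConst 5 0;
               NConst 7 0])
 (Seq copy_in
 (Seq (Blk [:: RConst0 1])
 (Seq suffix_sums
 (Seq coefficients
 (Seq (Blk [:: NAdd 8 14 6])
 (Seq (Unless 1 8 (sparse_product swap))
 (Seq (Blk [:: RConst0 1; NConst 5 0])
 (Seq prefix_sums copy_out)))))))))).

Lemma runs_query (R : realType) n swap (es : seq (nat * nat * nat)) N (X v : nat -> R) :
  preprocessed n es N ->
  (forall e, e \in es -> [/\ e.1.1 < n, e.1.2 < n & e.2 <= 4]) ->
  (forall m, m < n -> X m = v m) -> (forall x, n <= x -> X x = 0%R) ->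
  runs (query swap) N X (41 + n * 22 + size es * 16)
    (fun N' X' => forall m, m < n -> X' m =
      (\sum_(0 <= t < m.+1) \sum_(e <- es | entry_dst swap e == t)
         (e.2%:R - 2) * \sum_(entry_src swap e <= s < n) v s)%R).
Proof.
move=> [N0 pre] bnd Xv X0.
case: (posnP n) => [n0|n0].
  apply: (@runs_time _ _ _ _ (1 + 0.+1)); first by lia.
  have NS : N = split_mem (mkseq N 16) N by rewrite split_mem_mkseq.
  rewrite NS /mkseq [iota 0 16]/= [map _ _]/=.
  apply: runs_block_seq; first by [].
  repeat wp_step; apply: runs_unless; first by rewrite n0.
  by rewrite /split_mem /= N0 n0.
have [x2 [x3 [x4 [x5 [x7 [x8 [x9 [x10 [x11 [x12 [a [h [a16 -> st]]]]]]]]]]]]] := pre n0.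
(* The two copies cost [n * 5] each and the two summations [n * 6] each, which gives [n * 22]. *)
apply: (@runs_time _ _ _ _ (1 + (6 + (n * 5 + (1 + (n * 6 + (27 + (1 +
  ((size es * 16).+1 + (2 + (n * 6 + n * 5)))))))) ).+1)); first by lia.
apply: runs_block_seq; first by [].
rewrite /scan_regs; repeat wp_step; apply: runs_unless.
  by rewrite /split_mem /=; lia.
move=> _; apply: runs_block_seq; first by [].
repeat wp_step.
apply: runs_seq; apply: runs_conseq.
  exact: (runs_copy_in n0 _ _ _ _ _ _ _ _ _ _ Xv X0).
move=> ? X1 [y8 [-> XV1 XO1]].
apply: runs_block_seq; first by [].
repeat wp_step; apply: runs_seq; apply: runs_conseq.
  apply: (runs_suffix_sums (v := v) n0).
  - by [].
  - by move=> m lm; upd; apply: XV1.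
  - by move=> x lx; upd; apply: XO1.
move=> ? X2 [z8 [-> XV2 XO2]].
apply: runs_seq; apply: runs_conseq; first exact: (runs_coefficients
  (w := fun m => (\sum_(m <= s < n) v s)%R) n0 _ _ _ _ _ _ _ _ _ _ _ XV2 XO2).
move=> ? X3 [u8 [u9 [-> XV3 XO3 XT3]]].
apply: runs_block_seq; first by [].
rewrite /query_regs; repeat wp_step.
apply: runs_seq.
apply: (@runs_conseq _ _ _ _ _ (fun N' X' => exists x8 x9 x10 x11 x12 p,
       N' = split_mem (query_regs n (a + 3 * size es) 0 x8 x9 x10 x11 x12 2 p 3) h /\
       forall m, m < n -> X' (2 + n + n + m) =
         (\sum_(e <- es | entry_dst swap e == m)
            (e.2%:R - 2) * \sum_(entry_src swap e <= s < n) v s)%R)).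
  (* Register 8 is one more than the start of the list, so the test succeeds exactly when the list
     is empty. *)
  apply: runs_unless => lt.
    have es0 : es = [::].
      by apply/nilP; rewrite /nilp; move: lt; rewrite /split_mem /=; lia.
    do 6 eexists; split; first by reflexivity.
    by move=> m lm; rewrite es0 big_nil XO3.
  have es0 : 0 < size es by move: lt; rewrite /split_mem /=; lia.
  apply: runs_conseq.
    exact: (runs_sparse_product (w := fun m => (\sum_(m <= s < n) v s)%R)
      n0 swap _ _ _ _ _ _ _ _ es0 a16 st bnd XV3 XO3 XT3).
  move=> ? X4 [w8 [w9 [w10 [w11 [w12 [-> XO4]]]]]].
  by exists w8, w9, w10, w11, w12, (a + 3 * size es).
move=> ? X4 [w8 [w9 [w10 [w11 [w12 [p [-> XO4]]]]]]].
apply: runs_block_seq; first by [].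
rewrite /query_regs; repeat wp_step.
apply: runs_seq; apply: runs_conseq.
  apply: (runs_prefix_sums n0); first by [].
  by move=> m lm; upd; apply: XO4.
move=> ? X5 [t8 [-> XO5]].
exact: (runs_copy_out n0 _ _ _ _ _ _ _ _ _ _ XO5).
Qed.

Lemma mem_entries A n e : (forall i j, A i j <= 1) -> e \in entries A n n ->
  [/\ e.1.1 < n, e.1.2 < n & e.2 <= 4].
Proof.
move=> A1 /flattenP[r /mapP[i li ->] /mapP[j lj ->]] /=.
move: li lj; rewrite mem_filter !mem_iota !add0n => li /andP[_ lj]; split=> //.
by rewrite /corner; have := A1 i.+1 j.+1; have := A1 i j; lia.
Qed.

Lemma size_entries n (M : 'M[bool]_n) :
  size (entries (pad M) n n) = #|[set x : 'I_n * 'I_n | corner (pad M) x.1 x.2 != 2]|.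
Proof.
rewrite -sum1_card big_mkcond /=.
under eq_bigr => x _ do rewrite inE.
rewrite -(pair_bigA _ (fun i j : 'I_n => if corner (pad M) i j != 2 then 1 else 0)) /=.
rewrite size_flatten /shape -map_comp sumnE big_map -{1}(subn0 n).
rewrite -/(index_iota 0 n) big_mkord; apply: eq_bigr => i _.
rewrite /= size_map size_filter -sum1_count big_mkcond /=.
by rewrite -{1}(subn0 n) -/(index_iota 0 n) big_mkord.
Qed.

(** * Recovering the matrix product from second differences *)

Section Summation.
Variable R : realType.
Local Open Scope ring_scope.

(** Positions left out of the list have coefficient [2 - 2], so a summand that vanishes at the value
    2 can be summed over all positions. *)
Lemma sum_entries (A : nat -> nat -> nat) n m (P : pred (nat * nat * nat))
    (F : nat * nat * nat -> R) :
  (forall i j, F (i, j, 2%N) = 0) ->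
  \sum_(e <- entries A n m | P e) F e =
  \sum_(0 <= i < m) \sum_(0 <= j < n)
    (if P (i, j, corner A i j) then F (i, j, corner A i j) else 0).
Proof.
move=> F0; rewrite /entries big_flatten big_map -{1}(subn0 m).
rewrite -/(index_iota 0 m); apply: eq_bigr => i _.
rewrite big_map big_filter_cond -{1}(subn0 n) -/(index_iota 0 n).
rewrite big_mkcond; apply: eq_bigr => j _.
by case: eqP => [->|_] //=; rewrite F0; case: ifP.
Qed.

Lemma corner_real (A : nat -> nat -> nat) i j : (forall i j, (A i j <= 1)%N) ->
  (corner A i j)%:R - 2 =
  (A i.+1 j.+1)%:R + (A i j)%:R - (A i j.+1)%:R - (A i.+1 j)%:R :> R.
Proof.
move=> A1; rewrite /corner natrB ?natrD; first by ring.
by have := A1 i j.+1; have := A1 i.+1 j; lia.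
Qed.

(** Summation by parts. The limit [k] is separate from [n] to allow induction; at [k = n] the
    boundary term is an empty sum. *)
Lemma abel_sum n (e v : nat -> R) k : e 0%N = 0 -> (k <= n)%N ->
  \sum_(0 <= j < k) (e j.+1 - e j) * (\sum_(j <= s < n) v s) =
  e k * (\sum_(k <= s < n) v s) + \sum_(0 <= s < k) e s.+1 * v s.
Proof.
move=> e0; elim: k => [|k IHk] lk; first by rewrite big_geq // e0 mul0r add0r big_geq.
rewrite !(big_nat_recr k) //= IHk 1?ltnW // (big_ltn lk); ring.
Qed.

(** Entrywise form of the factorization applied to [v]: the sum over [t] telescopes, the sum over
    [j] is summed by parts. *)
Lemma double_abel_sum n (B : nat -> nat -> R) (v : nat -> R) m :
  (forall j, B 0%N j = 0) -> (forall i, B i 0%N = 0) ->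
  \sum_(0 <= t < m) \sum_(0 <= j < n)
    (B t.+1 j.+1 + B t j - B t j.+1 - B t.+1 j) * (\sum_(j <= s < n) v s) =
  \sum_(0 <= s < n) B m s.+1 * v s.
Proof.
move=> B0 Bc; elim: m => [|m IHm].
  by rewrite big_geq // big1 // => s _; rewrite B0 mul0r.
rewrite big_nat_recr //= IHm.
pose e j := B m.+1 j - B m j.
transitivity (\sum_(0 <= s < n) B m s.+1 * v s + \sum_(0 <= s < n) e s.+1 * v s).
  congr (_ + _).
  transitivity (\sum_(0 <= j < n) (e j.+1 - e j) * (\sum_(j <= s < n) v s)).
    by apply: eq_bigr => j _; congr (_ * _); rewrite /e; ring.
  by rewrite abel_sum ?leqnn /e ?Bc ?subrr // [\sum_(n <= s < n) _]big_geq //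
    mulr0 add0r.
by rewrite -big_split; apply: eq_bigr => s _; rewrite /= -mulrDl /e; congr (_ * _); ring.
Qed.

(** Second differences commute with transposition, so exchanging the indices of the entries replaces
    [A] by its transpose. *)
Lemma query_sum n swap (A : nat -> nat -> nat) (v : nat -> R) m :
  (forall i j, (A i j <= 1)%N) -> (forall j, A 0%N j = 0%N) ->
  (forall i, A i 0%N = 0%N) -> (m < n)%N ->
  \sum_(0 <= t < m.+1) \sum_(e <- entries A n n | entry_dst swap e == t)
    (e.2%:R - 2) * \sum_(entry_src swap e <= s < n) v s =
  \sum_(0 <= s < n)
    (if swap then A s.+1 m.+1 else A m.+1 s.+1)%:R * v s.
Proof.
move=> A1 A0 Ac lm.
pose B i j : R := (if swap then A j i else A i j)%:R.
rewrite -(@double_abel_sum n B) => [|j|i]; last 2 first.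
- by rewrite /B A0 Ac; case: (swap).
- by rewrite /B A0 Ac; case: (swap).
rewrite big_nat [RHS]big_nat; apply: eq_bigr => t /andP[_ lt].
have {}lt : (t < n)%N by apply: leq_trans lt lm.
rewrite sum_entries => [|i j]; last by rewrite subrr mul0r.
rewrite /B /entry_dst /entry_src; case: (swap) => /=.
  apply: eq_bigr => i _; rewrite -big_mkcond big_nat1_eq /= lt.
  by rewrite corner_real //; congr (_ * _); ring.
rewrite exchange_big /=; apply: eq_bigr => j _.
by rewrite -big_mkcond big_nat1_eq /= lt corner_real.
Qed.

End Summation.

Theorem theorem1 :
  exists (C : nat) (P Qcol Qrow : program),
  forall (R : realType) (n d : nat) (M : 'M[bool]_n),
    twin_ordered d M ->
    exists S : state R,
      runs_within P (C * (n ^ 2 + d.+1 * n) + C) (matrix_input R M) S /\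
      forall v : 'cV[R]_n,
        (exists S1 : state R,
           runs_within Qcol (C * (d.+1 * n) + C) (query_input S v) S1 /\
           forall i : 'I_n, rmem S1 i = (real_of_bmx R M *m v)%R i ord0) /\
        (exists S2 : state R,
           runs_within Qrow (C * (d.+1 * n) + C) (query_input S v) S2 /\
           forall i : 'I_n, rmem S2 i = (v^T *m real_of_bmx R M)%R ord0 i).
Proof.
(* A generous constant: preprocessing takes at most [28 * n ^ 2 + 8 * n + 89] steps and a query at
   most [64 * d * n + 22 * n + 57]. *)
exists 100, (code 0 preprocess), (code 0 (query false)), (code 0 (query true)).
move=> R n d M tM.
have sz : size (entries (pad M) n n) <= 4 * d * n + 1.
  by rewrite size_entries card_corners.
have timeP : 84 + n * 3 + (n * n).+1 * 5 + n * (n * 23 + 5) <=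
    100 * (n ^ 2 + d.+1 * n) + 100.
  by rewrite -mulnn; lia.
have timeQ : 41 + n * 22 + size (entries (pad M) n n) * 16 <=
    100 * (d.+1 * n) + 100.
  by lia.
have [S [runS [preS S0]]] := runs_halt (runs_time timeP (runs_preprocess R M)).
exists S; split=> // v.
pose vf (m : nat) : R := if insub m is Some i then v i ord0 else 0%R.
(* The real memory of [query_input S v]: [v] in front, and behind it the zeros that the
   preprocessing left untouched. *)
pose X a := match insub a : option 'I_n with
  | Some i => v i ord0 | None => rmem S a end.
have vfE (i : 'I_n) : vf i = v i ord0 by rewrite /vf valK.
have Xlt m : m < n -> X m = vf m.
  by move=> lm; rewrite /X /vf; case: insubP => // /negP[].
have Xge x : n <= x -> X x = 0%R.
  move=> lx; rewrite /X insubF; first by rewrite S0.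
  by rewrite ltnNge lx.
have bnd e : e \in entries (pad M) n n -> [/\ e.1.1 < n, e.1.2 < n & e.2 <= 4].
  by apply: mem_entries; apply: pad_le1.
have T swap :=
  runs_halt (runs_time timeQ (runs_query swap preS bnd Xlt Xge)).
have Qs swap m := @query_sum R n swap (pad M) vf m (@pad_le1 n M)
  (fun _ => erefl) (fun i => ltac:(by case: i)).
split.
- have [S1 [run1 out1]] := T false; exists S1; split=> // i.
  rewrite out1 // Qs // mxE big_mkord; apply: eq_bigr => s _.
  by rewrite padS vfE mxE.
- have [S1 [run1 out1]] := T true; exists S1; split=> // i.
  rewrite out1 // Qs // mxE big_mkord; apply: eq_bigr => s _.
  by rewrite padS vfE !mxE mulrC.
Qed.
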